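(* Let $\ell$ be a prime and let $a\in\mathbb{Z}$. Then $c\phi_2(\ell n+a)\equiv 0 \pmod{\ell}$ holds for all $n\in\mathbb{Z}$ if and only if either $\ell=2$ and $a\equiv 1\pmod 2$, or $\ell=5$ and $a\equiv 3\pmod 5$.
   Context: An $F$-partition (generalized Frobenius partition) of $n\ge 0$ is a representation $n=r+\sum_{i=1}^r a_i+\sum_{i=1}^r b_i$ (with $r\ge 0$) where $(a_i)$ and $(b_i)$ are both strictly decreasing sequences of non-negative integers; it is written as a two-row array with rows $a_1\,a_2\cdots a_r$ and $b_1\,b_2\cdots b_r$. An $F$-partition is 2-colored if its entries are taken from two copies of the non-negative integers, written $j_i$ with $j\ge 0$ and color $i\in\{1,2\}$, ordered by $j_i<r_s$ if $j<r$, or if $j=r$ and $i<s$; each row is strictly decreasing in this order, and $j_i$ contributes its value $j$ to the sum. $c\phi_2(n)$ denotes the number of 2-colored $F$-partitions of $n$; $c\phi_2(0)=1$, and $c\phi_2(n)=0$ for $n<0$. *)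

(* Defs.v *)
From HB Require Import structures.
From mathcomp Require Import all_boot all_order all_algebra.
Set Implicit Arguments.
Unset Strict Implicit.
Unset Printing Implicit Defensive.
Import Order.TTheory GRing.Theory Num.Theory.

(* An entry (j, i) stands for j_{i+1}: the colors 1, 2 are encoded as 0, 1.   *)
(* The order on [*l] is lexicographic, with the value compared first.         *)
Notation entry := (nat *l 'I_2)%type.

Definition strictly_decreasing (s : seq entry) : bool :=
  sorted (fun x y => (y < x)%O) s.

Definition row_sum (s : seq entry) : nat := \sum_(x <- s) x.1.

Definition is_Fpartition2 (n : nat) (p : seq entry * seq entry) : bool :=
  [&& size p.1 == size p.2,
      strictly_decreasing p.1, strictly_decreasing p.2
    & size p.1 + row_sum p.1 + row_sum p.2 == n].

Definition entry_of_bounded (n : nat) (x : 'I_n.+1 * 'I_2) : entry :=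
  (nat_of_ord x.1, x.2).

Definition rows_of_bounded (n r : nat)
    (p : r.-tuple ('I_n.+1 * 'I_2) * r.-tuple ('I_n.+1 * 'I_2)) :
    seq entry * seq entry :=
  (map (@entry_of_bounded n) p.1, map (@entry_of_bounded n) p.2).

(* In an F-partition of n the rows have length at most n and the entries have *)
(* values at most n, so the count is over a finite type; [cphi2_natE] below   *)
(* shows that these bounds lose nothing.                                      *)
Definition cphi2_nat (n : nat) : nat :=
  \sum_(r < n.+1)
    #|[set p : r.-tuple ('I_n.+1 * 'I_2) * r.-tuple ('I_n.+1 * 'I_2)
      | is_Fpartition2 n (rows_of_bounded p)]|.

Definition cphi2 (n : int) : nat :=
  if n is Posz m then cphi2_nat m else 0.

Lemma entry_of_bounded_inj n : injective (@entry_of_bounded n).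
Proof. by case=> i c [j d] [/val_inj -> ->]. Qed.

Lemma rows_of_bounded_inj n r : injective (@rows_of_bounded n r).
Proof.
by case=> a b [c d] [/(inj_map (@entry_of_bounded_inj n))/val_inj ->
  /(inj_map (@entry_of_bounded_inj n))/val_inj ->].
Qed.

Lemma bounded_row n (s : seq entry) : row_sum s <= n ->
  exists t : (size s).-tuple ('I_n.+1 * 'I_2),
    map (@entry_of_bounded n) t = s.
Proof.
move=> hs; pose f (x : entry) : 'I_n.+1 * 'I_2 := (inord x.1, x.2).
exists (map_tuple f (in_tuple s)); rewrite /= -map_comp map_id_in // => x xs.
have hx : x.1 <= n.
  by apply: leq_trans hs; rewrite /row_sum (big_rem x) //= leq_addr.
by rewrite /entry_of_bounded /= inordK //; case: x {xs hx}.
Qed.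

Lemma cphi2_natE (n : nat) (s : seq (seq entry * seq entry)) :
  uniq s -> (forall p, (p \in s) = is_Fpartition2 n p) -> cphi2_nat n = size s.
Proof.
move=> us ms.
pose A r := [set p : r.-tuple ('I_n.+1 * 'I_2) * r.-tuple ('I_n.+1 * 'I_2)
              | is_Fpartition2 n (rows_of_bounded p)].
pose L r := [seq rows_of_bounded p | p <- enum (A r)].
have memL r p : (p \in L r) = (size p.1 == r) && is_Fpartition2 n p.
  apply/mapP/andP => [[q]|[/eqP <-]].
    by rewrite mem_enum inE => hq -> /=; rewrite size_map size_tuple.
  case: p => a b hF; have /and4P[/= /eqP sab _ _ /eqP hn] := hF.
  have [|t ta] := @bounded_row n a; first by rewrite -hn addnAC leq_addl.
  have [|u ub] := @bounded_row n b; first by rewrite -hn leq_addl.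
  rewrite -sab in u ub *.
  have e : (a, b) = rows_of_bounded (t, u) by rewrite /rows_of_bounded /= ta ub.
  by exists (t, u); rewrite // mem_enum inE -e.
have sizeL r : size (L r) = #|A r| by rewrite size_map -cardE.
have uL r : uniq (L r).
  by rewrite map_inj_uniq ?enum_uniq //; apply: rows_of_bounded_inj.
have sizeF r : #|A r| = count (fun p => size p.1 == r) s.
  rewrite -sizeL -size_filter; apply/perm_size/uniq_perm => //.
    exact: filter_uniq.
  by move=> p; rewrite memL mem_filter ms.
transitivity (\sum_(r < n.+1) count (fun p => size p.1 == r) s).
  by apply: eq_bigr => r _; rewrite -sizeF.
under eq_bigr do rewrite -sum1_count big_mkcond /=.
rewrite exchange_big /= -sum1_size; apply: eq_big_seq => p.
rewrite ms => /and4P[_ _ _ /eqP hn].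
have hp : size p.1 < n.+1 by rewrite -hn ltnS -addnA leq_addr.
by rewrite -big_mkcond (big_pred1 (Ordinal hp)).
Qed.

(* Main.v *)
From HB Require Import structures.
Require Import Defs.
From mathcomp Require Import all_boot all_order all_algebra all_field.
From mathcomp Require Import boolp.
From mathcomp Require Import zify ring ssrZ.
From Stdlib Require ZArith.
Import Order.TTheory GRing.Theory Num.Theory.

(** Let C be the generating function of c phi_2.  Rows of length r are counted by the
    coefficient of x^r in e(x)^2, where e is Euler's product, and sorting by Durfee
    rectangles instead gives C = p^2 theta (cphi_series_theta), where p is the
    generating function of the partitions and theta the sum of the q^(m^2).

    Work over a field K of odd characteristic l = 2h + 1.  With z = theta(q)^2 and
    b = theta(-q)^2, let lambda be 1 - b^2 / z^2 and D the derivation q d/dq.  The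
    arithmetic-geometric mean relates (z, b) to their values at q^2, and series with a
    given behaviour under q -> q^2 are determined by few coefficients.  This gives the
    facts that usually come from modular forms: D lambda = lambda (1 - lambda) z^2
    (eulerD_lambda), lambda (1 - lambda)^4 z^6 C^12 = 16 q (cphi_lambda), and
    H(lambda) z^(2h) = 1 for the Hasse polynomial H (hasse_lambda), whose roots are
    simple by the hypergeometric equation (hasse_root_simple).

    Take u with 12u = -1 mod l.  Up to a constant, f = q^u C is then G(lambda), where
    G = X^u (1 - X)^(4u) H^h, times an l-th power, which D treats as a constant
    (cphi_polyE), and D acts on polynomials in lambda through the operator
    P -> X (1 - X) H^2 P' (hasse_op).  A congruence modulo l in the class of a says that
    the coefficients of f vanish in the class of r = a + u.  Let K be algebraically
    closed and l > 5.

    If l does not divide r, Fermat's theorem turns the vanishing into an equation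
    between D f, ..., D^(l-1) f, hence into a relation of degree less than h in
    y = z^(-2l) over K(lambda).  As y^h = H(lambda)^l with l prime to h, its
    coefficients are zero by Kummer theory (kummer_independent); but one of them has
    multiplicity exactly l at the roots of H (no_congruence_nonzero).

    If l divides r, it says D^(l-1) f = f.  Following the multiplicity at the roots of H
    through the l - 1 derivatives, in the manner of the theta cycles of modular forms
    mod l, one finds D^(h+2) f = f z^4 R(lambda) with R of degree at most 2
    (congruence_zero).  So the numbers (12m-1)^(h+2) c phi_2(m) are the coefficients of a
    series in a space of dimension 3, and those for m = 0, ..., 4 satisfy two linear
    relations with integral coefficients (weight4_relations).  Since (12m-1)^h is 1, -1
    or 0, they become relations between five signs, and for each choice of the signs
    the two integers in question have a greatest common divisor that divides 30^6.

    For l = 2 the series theta is 1, so that C is a square; for l = 5, q^2 C times a fifth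
    power is a derivative.  The values 1, 4, 9, 42, 80 of c phi_2 at 0, 1, 2, 4, 5 exclude
    the other classes modulo 2, 3 and 5. *)

Set Implicit Arguments.
Unset Strict Implicit.
Unset Printing Implicit Defensive.

Local Open Scope ring_scope.

(** * Formal power series *)

Record fps (R : Type) := Fps { fcoef :> nat -> R }.

HB.instance Definition _ (R : Type) := gen_eqMixin (fps R).
HB.instance Definition _ (R : Type) := gen_choiceMixin (fps R).

Lemma fpsP (R : Type) (f g : fps R) : f = g <-> f =1 g.
Proof.
split=> [-> //|]; case: f g => f [g] /= fg.
by congr Fps; apply/funext.
Qed.

Section FpsRing.
Variable R : comNzRingType.
Implicit Types f g h : fps R.

Definition fps_zero : fps R := Fps (fun _ => 0).
Definition fps_opp f := Fps (fun n => - f n).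
Definition fps_add f g := Fps (fun n => f n + g n).
Definition fps_one : fps R := Fps (fun n => (n == 0)%:R).

(* Locking keeps unification from comparing the coefficients of two products. *)
Fact fps_key : unit. Proof. exact: tt. Qed.
Definition fps_mul f g : fps R :=
  locked_with fps_key (Fps (fun n => \sum_(i < n.+1) f i * g (n - i)%N)).

Lemma fps_mul_coef f g n : fps_mul f g n = \sum_(i < n.+1) f i * g (n - i)%N.
Proof. by rewrite /fps_mul locked_withE. Qed.

Fact fps_addA : associative fps_add.
Proof. by move=> f g h; apply/fpsP => n /=; rewrite addrA. Qed.
Fact fps_addC : commutative fps_add.
Proof. by move=> f g; apply/fpsP => n /=; rewrite addrC. Qed.
Fact fps_add0 : left_id fps_zero fps_add.
Proof. by move=> f; apply/fpsP => n /=; rewrite add0r. Qed.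
Fact fps_addN : left_inverse fps_zero fps_opp fps_add.
Proof. by move=> f; apply/fpsP => n /=; rewrite addNr. Qed.

HB.instance Definition _ := GRing.isZmodule.Build (fps R)
  fps_addA fps_addC fps_add0 fps_addN.

Definition truncf N f : {poly R} := \poly_(i < N) f i.

Lemma fps_mul_trunc N f g n : (n < N)%N ->
  fps_mul f g n = (truncf N f * truncf N g)`_n.
Proof.
move=> nN; rewrite coefM fps_mul_coef; apply: eq_bigr => i _.
by rewrite !coef_poly (leq_ltn_trans (leq_subr _ _) nN)
  (leq_ltn_trans _ nN) // -ltnS.
Qed.

Fact fps_mulC : commutative fps_mul.
Proof.
by move=> f g; apply/fpsP => n; rewrite !(@fps_mul_trunc n.+1) // mulrC.
Qed.

Fact fps_mulA : associative fps_mul.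
Proof.
move=> f g h; apply/fpsP => n.
transitivity ((truncf n.+1 f * truncf n.+1 g * truncf n.+1 h)`_n).
  rewrite fps_mul_coef -mulrA coefM /=; apply: eq_bigr => i _.
  rewrite coef_poly ltn_ord -(@fps_mul_trunc n.+1) //.
  by rewrite ltnS leq_subr.
rewrite fps_mul_coef coefM /=; apply: eq_bigr => i _.
by rewrite [(truncf _ h)`_ _]coef_poly ltnS leq_subr -(@fps_mul_trunc n.+1).
Qed.

Fact fps_mul1 : left_id fps_one fps_mul.
Proof.
move=> f; apply/fpsP => n; rewrite fps_mul_coef big_ord_recl /= mul1r subn0 big1 ?addr0 //.
by move=> i _; rewrite mul0r.
Qed.

Fact fps_mulDl : left_distributive fps_mul fps_add.
Proof.
move=> f g h; apply/fpsP => n; rewrite /= !fps_mul_coef -big_split /=.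
by apply: eq_bigr => i _; rewrite mulrDl.
Qed.

Fact fps_1neq0 : fps_one != 0.
Proof. by apply/eqP => /fpsP/(_ 0)/eqP; rewrite /= oner_eq0. Qed.

HB.instance Definition _ := GRing.Zmodule_isComNzRing.Build (fps R)
  fps_mulA fps_mulC fps_mul1 fps_mulDl fps_1neq0.

Lemma fps0E n : (0 : fps R) n = 0. Proof. by []. Qed.
Lemma fps1E n : (1 : fps R) n = (n == 0)%:R. Proof. by []. Qed.
Lemma fpsDE f g n : (f + g) n = f n + g n. Proof. by []. Qed.
Lemma fpsBE f g n : (f - g) n = f n - g n. Proof. by []. Qed.
Lemma fpsME f g n : (f * g) n = \sum_(i < n.+1) f i * g (n - i)%N.
Proof. exact: fps_mul_coef. Qed.

Lemma fps_sumE (I : Type) (r : seq I) (P : pred I) (F : I -> fps R) n :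
  (\sum_(i <- r | P i) F i) n = \sum_(i <- r | P i) F i n.
Proof. exact: (big_morph (fun f : fps R => f n)). Qed.

Lemma fpsMn f k n : (f *+ k) n = f n *+ k.
Proof. by elim: k => // k IH; rewrite !mulrS fpsDE IH. Qed.

Lemma fpsM0 f g : (f * g) 0 = f 0 * g 0.
Proof. by rewrite fpsME big_ord_recl big_ord0 addr0. Qed.

Lemma fpsM1 f g : (f * g) 1 = f 0 * g 1 + f 1 * g 0.
Proof. by rewrite fpsME !big_ord_recl big_ord0 addr0. Qed.

Lemma fpsX0 f k : (f ^+ k) 0 = f 0 ^+ k.
Proof. by elim: k => // k IH; rewrite !exprS fpsM0 IH. Qed.

(** ** Constants, monomials and rescaling *)

Definition fpsC (c : R) : fps R := Fps (fun n => c *+ (n == 0)).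

Fact fpsC_is_zmod_morphism : zmod_morphism fpsC.
Proof. by move=> a b; apply/fpsP => n; rewrite fpsBE /= mulrnBl. Qed.

Lemma fpsCME c f n : (fpsC c * f) n = c * f n.
Proof.
rewrite fpsME big_ord_recl /= subn0 big1 ?addr0 // => i _.
by rewrite mulr0n mul0r.
Qed.

Fact fpsC_is_monoid_morphism : monoid_morphism fpsC.
Proof.
split=> [|a b]; apply/fpsP => n //.
by rewrite fpsCME /= mulrnAr.
Qed.

HB.instance Definition _ :=
  GRing.isZmodMorphism.Build R (fps R) fpsC fpsC_is_zmod_morphism.
HB.instance Definition _ :=
  GRing.isMonoidMorphism.Build R (fps R) fpsC fpsC_is_monoid_morphism.

Definition qvar : fps R := Fps (fun n => (n == 1)%:R).

Lemma qvarME f n : (qvar * f) n.+1 = f n.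
Proof.
rewrite fpsME !big_ord_recl /= subSS !subn0 mul0r add0r mul1r big1 ?addr0 // => i _.
by rewrite mul0r.
Qed.

Lemma qvarME0 f : (qvar * f) 0 = 0.
Proof. by rewrite fpsM0 mul0r. Qed.

Lemma qvarXME f k n : (qvar ^+ k * f) n = if (k <= n)%N then f (n - k)%N else 0.
Proof.
elim: k n => [|k IH] [|n]; rewrite ?expr0 ?mul1r ?leq0n ?subn0 //.
  by rewrite exprS -mulrA qvarME0.
by rewrite exprS -mulrA qvarME IH.
Qed.

Lemma qvarXE k n : (qvar ^+ k) n = (n == k)%:R.
Proof.
by rewrite -[_ ^+ k]mulr1 qvarXME fps1E subn_eq0; case: ltngtP.
Qed.

Definition scale (c : R) f : fps R := Fps (fun n => c ^+ n * f n).

Fact scale_is_zmod_morphism c : zmod_morphism (scale c).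
Proof. by move=> f g; apply/fpsP => n; rewrite -[LHS]/(c ^+ n * (f n - g n)) mulrBr. Qed.

Fact scale_is_monoid_morphism c : monoid_morphism (scale c).
Proof.
split=> [|f g]; apply/fpsP => n /=.
  by case: n => [|n]; rewrite ?expr0 ?mul1r //= mulr0.
rewrite !fpsME mulr_sumr; apply: eq_bigr => i _ /=.
by rewrite mulrACA -exprD subnKC // -ltnS.
Qed.

HB.instance Definition _ c :=
  GRing.isZmodMorphism.Build (fps R) (fps R) (scale c) (scale_is_zmod_morphism c).
HB.instance Definition _ c :=
  GRing.isMonoidMorphism.Build (fps R) (fps R) (scale c)
    (scale_is_monoid_morphism c).

(** ** The substitution of q^2 for q and the Euler derivation *)

Definition dil f : fps R := Fps (fun n => if odd n then 0 else f n./2).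

Fact dil_is_zmod_morphism : zmod_morphism dil.
Proof.
by move=> f g; apply/fpsP => n; rewrite fpsBE /=; case: odd; rewrite ?subr0.
Qed.

Lemma dil_double f n : dil f n.*2 = f n.
Proof. by rewrite /= odd_double doubleK. Qed.

Lemma dil_odd f n : odd n -> dil f n = 0.
Proof. by move=> /= ->. Qed.

Fact dil_is_monoid_morphism : monoid_morphism dil.
Proof.
split=> [|f g]; apply/fpsP => n; first by case: n => [|[|n]] //=; case: odd.
pose p := truncf n.+1 f; pose r := truncf n.+1 g.
have dilE (h : fps R) i : (i < n.+1)%N ->
    dil h i = (truncf n.+1 h \Po 'X^2)`_i.
  move=> iN; rewrite coef_comp_poly_Xn // dvdn2 divn2 coef_poly /=.
  case: odd => //=; rewrite (leq_ltn_trans _ iN) //.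
  by rewrite -{2}[i]odd_double_half -addnn; lia.
transitivity (((p \Po 'X^2) * (r \Po 'X^2))`_n).
  rewrite -comp_polyM coef_comp_poly_Xn // dvdn2 divn2.
  rewrite -[LHS]/(if odd n then 0 else fps_mul f g n./2).
  case: (odd n) => //; rewrite (@fps_mul_trunc n.+1) //.
  by rewrite ltnS -{2}[n]odd_double_half -addnn; lia.
rewrite coefM fpsME; apply: eq_bigr => i _.
by rewrite -!dilE // ltnS leq_subr.
Qed.

HB.instance Definition _ :=
  GRing.isZmodMorphism.Build (fps R) (fps R) dil dil_is_zmod_morphism.
HB.instance Definition _ :=
  GRing.isMonoidMorphism.Build (fps R) (fps R) dil dil_is_monoid_morphism.

Definition eulerD f : fps R := Fps (fun n => n%:R * f n).

Fact eulerD_is_zmod_morphism : zmod_morphism eulerD.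
Proof. by move=> f g; apply/fpsP => n; rewrite -[LHS]/(n%:R * (f n - g n)) mulrBr. Qed.

HB.instance Definition _ :=
  GRing.isZmodMorphism.Build (fps R) (fps R) eulerD eulerD_is_zmod_morphism.

Lemma eulerDM f g : eulerD (f * g) = eulerD f * g + f * eulerD g.
Proof.
apply/fpsP => n; rewrite -[LHS]/(n%:R * (f * g) n) fpsDE.
rewrite !fpsME -big_split mulr_sumr; apply: eq_bigr => i _ /=.
rewrite -{1}(@subnKC i n) -1?ltnS // natrD mulrDl.
by rewrite mulrA mulrCA.
Qed.

Lemma eulerDC c : eulerD (fpsC c) = 0.
Proof. by apply/fpsP => -[|n] /=; rewrite ?mul0r // mulr0. Qed.

Lemma eulerD1 : eulerD 1 = 0.
Proof. by rewrite -(rmorph1 fpsC) eulerDC. Qed.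

Lemma eulerDX f k : eulerD (f ^+ k) = (f ^+ k.-1 * eulerD f) *+ k.
Proof.
elim: k => [|k IH]; first by rewrite expr0 eulerD1.
rewrite exprS eulerDM IH mulrnAr [k.+1.-1]/= -[in RHS]addn1 mulrnDr addrC mulr1n.
rewrite [eulerD f * _]mulrC; congr (_ + _).
by case: k {IH} => // k; rewrite mulrA -exprS.
Qed.

Lemma eulerD_dil f : eulerD (dil f) = dil (eulerD f) *+ 2.
Proof.
apply/fpsP => n; rewrite fpsMn /=; have [on|en] := boolP (odd n).
  by rewrite mulr0 mul0rn.
have := even_halfK en; move: n./2 => m <-.
by rewrite -muln2 natrM mulrAC mulr_natr.
Qed.

End FpsRing.

(** ** Evaluation of a polynomial at a series *)

HB.lock Definition peval (R : comNzRingType) (f : fps R) (p : {poly R}) : fps R :=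
  (map_poly (@fpsC R) p).[f].

Section Peval.
Variable R : comNzRingType.
Implicit Types (f : fps R) (p : {poly R}).

Fact peval_is_zmod_morphism f : zmod_morphism (peval f).
Proof. by move=> p r; rewrite peval.unlock rmorphB hornerD hornerN. Qed.

Fact peval_is_monoid_morphism f : monoid_morphism (peval f).
Proof.
by split=> [|p r]; rewrite peval.unlock ?rmorph1 ?hornerC // rmorphM hornerM.
Qed.

HB.instance Definition _ f :=
  GRing.isZmodMorphism.Build {poly R} (fps R) (peval f) (peval_is_zmod_morphism f).
HB.instance Definition _ f :=
  GRing.isMonoidMorphism.Build {poly R} (fps R) (peval f)
    (peval_is_monoid_morphism f).

Lemma pevalX f : peval f 'X = f.
Proof. by rewrite peval.unlock map_polyX hornerX. Qed.

Lemma pevalC f c : peval f c%:P = fpsC c.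
Proof. by rewrite peval.unlock map_polyC hornerC. Qed.

Lemma peval_MXaddC f p c : peval f (p * 'X + c%:P) = peval f p * f + fpsC c.
Proof. by rewrite rmorphD rmorphM /= pevalX pevalC. Qed.

Lemma peval_coef0 f p : f 0 = 0 -> (peval f p) 0 = p`_0.
Proof.
move=> f0; elim/poly_ind: p => [|p c IH]; first by rewrite rmorph0 coef0.
rewrite peval_MXaddC fpsDE fpsM0 f0 mulr0 add0r /= mulr1n.
by rewrite coefD coefMX coefC add0r.
Qed.

Lemma eulerD_peval f p : eulerD (peval f p) = peval f p^`() * eulerD f.
Proof.
elim/poly_ind: p => [|p c IH]; first by rewrite rmorph0 !raddf0 mul0r.
rewrite derivD derivC addr0 derivM derivX mulr1 peval_MXaddC.
by rewrite rmorphD rmorphM /= pevalX raddfD /= eulerDC addr0 eulerDM IH mulrDl mulrAC.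
Qed.

Lemma peval_dil f p : dil (peval f p) = peval (dil f) p.
Proof.
elim/poly_ind: p => [|p c IH]; first by rewrite !rmorph0.
rewrite !peval_MXaddC rmorphD rmorphM /= IH; congr (_ + _).
by apply/fpsP => -[|[|n]] //=; case: odd.
Qed.

End Peval.

(** ** Power series over a field *)

Section FpsField.
Variable K : fieldType.
Implicit Types f g : fps K.

(* The n-th coefficient of 1 / f is found from the previous ones, listed here *)
(* in reverse order. *)
Fixpoint fps_inv_rec f n : seq K :=
  if n is m.+1 then
    let s := fps_inv_rec f m in
    (- (f 0)^-1 * \sum_(i < m.+1) f i.+1 * s`_i) :: s
  else [:: (f 0)^-1].

Definition fps_unit f := f 0 != 0.
Definition fps_inv f : fps K := locked_with fps_key
  (if fps_unit f then Fps (fun n => (fps_inv_rec f n)`_0) else f).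

Lemma fps_inv_recE f n i : (i <= n)%N ->
  (fps_inv_rec f n)`_i = (fps_inv_rec f (n - i))`_0.
Proof.
elim: n i => [|n IH] [|i] //=; rewrite ?subn0 ?subSS //.
exact: IH.
Qed.

Fact fps_mulVf : {in fps_unit, left_inverse 1 fps_inv *%R}.
Proof.
move=> f fu; have {fu}fu : f 0 != 0 by [].
rewrite mulrC /fps_inv locked_withE /fps_unit fu.
apply/fpsP => -[|n]; first by rewrite fpsM0 /= divff.
rewrite fpsME big_ord_recl subn0 [fcoef (Fps _) _]/= mulrA mulrN divff // mulN1r.
apply/eqP; rewrite fps1E addrC subr_eq0; apply/eqP/eq_bigr => i _ /=.
by rewrite subSS -fps_inv_recE // -ltnS.
Qed.

Fact fps_unitP f g : g * f = 1 -> fps_unit f.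
Proof.
move=> /fpsP/(_ 0); rewrite fpsM0 fps1E /= => gf; apply/eqP => f0.
by move: gf => /eqP; rewrite f0 mulr0 eq_sym oner_eq0.
Qed.

Fact fps_inv_out : {in [predC fps_unit], fps_inv =1 id}.
Proof. by move=> f nf; rewrite /fps_inv locked_withE; case: ifP => // /(negP nf). Qed.

HB.instance Definition _ := GRing.ComNzRing_hasMulInverse.Build (fps K)
  fps_mulVf fps_unitP fps_inv_out.

Lemma fps_unitE f : (f \is a GRing.unit) = (f 0 != 0).
Proof. by []. Qed.

Lemma fps_order f : f != 0 ->
  exists n, exists2 g : fps K, g 0 != 0 & f = qvar K ^+ n * g.
Proof.
move=> f0; have [n fn] : exists n, f n != 0.
  apply: contrapT => none; case/eqP: f0; apply/fpsP => n.
  by apply/eqP/negPn/negP => fn; apply: none; exists n.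
case: (ex_minnP (ex_intro (fun n => f n != 0) n fn)) => m fm min_m.
exists m; exists (Fps (fun i => f (m + i)%N)); first by rewrite /= addn0.
apply/fpsP => i; rewrite qvarXME /=; case: leqP => [mi|im].
  by rewrite subnKC.
by apply/eqP; apply: contraTT im => /min_m; rewrite -leqNgt.
Qed.

Fact fps_integral : GRing.integral_domain_axiom (fps K).
Proof.
move=> f g fg; apply/norP => -[/fps_order[m [f1 f10 fE]] /fps_order[n [g1 g10 gE]]].
move: fg => /fpsP/(_ (m + n)%N)/eqP; apply/negP; rewrite fE gE mulrACA -exprD.
by rewrite qvarXME leqnn subnn fpsM0 mulf_neq0.
Qed.

HB.instance Definition _ := GRing.ComUnitRing_isIntegral.Build (fps K)
  fps_integral.

Lemma peval_inj f : f 0 = 0 -> f 1 != 0 -> injective (peval f).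
Proof.
move=> f0 f1 p r pr; apply/eqP; rewrite -subr_eq0; apply/negPn/negP => n0.
have [m [q nq qE]] := multiplicity_XsubC (p - r) 0.
have := congr1 (peval f) qE; rewrite rmorphB /= pr subrr polyC0 subr0.
rewrite rmorphM rmorphXn /= pevalX => /esym/eqP; apply/negP.
rewrite mulf_neq0 ?expf_neq0 //; last first.
  by apply: contraNneq f1 => ->.
apply: contraTneq nq => q0; rewrite n0 /= negbK.
by rewrite /root horner_coef0 -(peval_coef0 _ f0) q0.
Qed.

(** Together with [dil_contract], this replaces the theory of modular forms: an
    identity follows once both sides transform alike under q -> q^2. *)
Lemma dil_fixed f : f = dil f -> f = fpsC (f 0).
Proof.
move=> fE; apply/fpsP => n; elim/ltn_ind: n => -[//|n] IH.
rewrite fE; have [on|on] := boolP (odd n.+1); first by rewrite dil_odd.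
have [m mn nE] : exists2 m, (m.+1 < n.+1)%N & n.+1 = m.+1.*2.
  by exists n./2; lia.
by rewrite nE dil_double IH.
Qed.

(** The valuation of dil f is twice that of f, while multiplication by [k]
    adds only one to it; hence a nonzero f has valuation at most 1. *)
Lemma dil_contract (k : fps K) g f : k 0 = 0 -> k 1 != 0 -> f 0 = 0 -> f 1 = 0 ->
  k * f = g * dil f -> f = 0.
Proof.
move=> k0 k1 f0 f1 kf; apply/fpsP => n; rewrite fps0E.
elim/ltn_ind: n => -[//|[//|n]] IH.
move: kf => /fpsP/(_ n.+3); rewrite !fpsME big_ord_recl k0 mul0r add0r.
rewrite big_ord_recl /= subSS subn0 big1 ?addr0; last first.
  by move=> i _ /=; rewrite /bump /= !add1n !subSS IH ?mulr0 //; lia.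
rewrite big1 => [/eqP|i _ /=]; first by rewrite mulf_eq0 (negPf k1) => /eqP.
case: ifP => _; first by rewrite mulr0.
by rewrite IH ?mulr0 //; lia.
Qed.

End FpsField.

(** * Counting the rows of 2-colored F-partitions *)

Section Rows.
Local Open Scope nat_scope.

Definition rows (r m : nat) : seq (seq entry) :=
  [seq s <- [seq map (@entry_of_bounded m) (tval t)
            | t <- enum {: r.-tuple ('I_m.+1 * 'I_2)}]
  | strictly_decreasing s && (row_sum s == m)].

Lemma mem_rows r m s :
  (s \in rows r m) = [&& size s == r, strictly_decreasing s & row_sum s == m].
Proof.
rewrite mem_filter andbC; apply/idP/idP => /andP[].
  by move=> /mapP[t _ ->] ->; rewrite size_map size_tuple eqxx.
move=> /eqP sr /andP[ds /eqP sm]; rewrite ds sm eqxx !andbT.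
have [|t ts] := @bounded_row m s; first by rewrite sm.
rewrite -sr; apply/mapP; exists t; rewrite ?mem_enum //.
Qed.

Lemma rows_uniq r m : uniq (rows r m).
Proof.
rewrite filter_uniq // map_inj_uniq ?enum_uniq //.
by move=> t u /(inj_map (@entry_of_bounded_inj m))/val_inj.
Qed.

Definition shift_entry (x : entry) : entry := (x.1.+1, x.2).
Definition col1 : entry := (0, ord0).
Definition col2 : entry := (0, ord_max).
Definition zero_tails : seq (seq entry) :=
  [:: [::]; [:: col1]; [:: col2]; [:: col2; col1]].

Lemma entry_ltE (x y : entry) :
  (x < y)%O = (x.1 < y.1) || (x.1 == y.1) && (x.2 < y.2).
Proof.
rewrite Order.ProdLexiOrder.ltEprodlexi !leEnat ltEord.
by case: (ltngtP x.1 y.1) => _ //=; rewrite ?andbF.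
Qed.

Lemma entry_trans : transitive (fun x y : entry => (y < x)%O).
Proof. by move=> y x z xy yz; apply: lt_trans yz xy. Qed.

Lemma decreasing_cons x s : strictly_decreasing (x :: s) =
  all (fun y => (y < x)%O) s && strictly_decreasing s.
Proof. by rewrite /strictly_decreasing /= path_sortedE //; exact: entry_trans. Qed.

Lemma zero_entry (x : entry) : x.1 = 0 -> x = col1 \/ x = col2.
Proof.
case: x => -[|v] [[|[|c]] hc] //= _; [left|right]; congr (_, _); exact: val_inj.
Qed.

Lemma decreasing_shift s t : t \in zero_tails ->
  strictly_decreasing (map shift_entry s ++ t) = strictly_decreasing s.
Proof.
move=> tz; elim: s => [|x s IH].
  by move: tz; rewrite /= !inE => /or4P[]/eqP->.
rewrite map_cons cat_cons !decreasing_cons IH all_cat all_map; congr andb.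
rewrite [X in _ && X](_ : _ = true) ?andbT; last first.
  by move: tz; rewrite !inE => /or4P[]/eqP->; rewrite /= ?entry_ltE.
by apply: eq_all => y; rewrite /= !entry_ltE.
Qed.

Lemma decreasing_split s : strictly_decreasing s ->
  exists2 s', exists2 t, t \in zero_tails & s = map shift_entry s' ++ t & True.
Proof.
elim: s => [|x s IH]; first by exists [::] => //; exists [::].
rewrite decreasing_cons => /andP[xs /IH[s' [t tz sE] _]].
have [x0|x0] := eqVneq x.1 0; last first.
  exists ((x.1.-1, x.2) :: s') => //; exists t => //=; rewrite -sE.
  by case: x x0 {xs} => -[].
exists [::] => //; exists (x :: s) => //=.
have s'0 : s' = [::].
  case: s' sE xs => // y s' ->; by rewrite /= entry_ltE /= x0.
move: sE xs; rewrite {}s'0 /= => ->.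
move: tz; rewrite /zero_tails !inE.
have [->|->] := zero_entry x0; case/or4P => /eqP -> //=;
  by rewrite !entry_ltE /= ?eqxx ?orbT.
Qed.

Lemma row_sum_cat s t : row_sum (s ++ t) = row_sum s + row_sum t.
Proof. by rewrite /row_sum big_cat. Qed.

Lemma row_sum_shift s : row_sum (map shift_entry s) = row_sum s + size s.
Proof.
rewrite /row_sum big_map /= -sum1_size -big_split /=.
by apply: eq_bigr => x _; rewrite addn1.
Qed.

Lemma shift_cat_inj s t s' t' : t \in zero_tails -> t' \in zero_tails ->
  map shift_entry s ++ t = map shift_entry s' ++ t' -> s = s' /\ t = t'.
Proof.
have shift_inj : injective shift_entry by case=> v c [w d] [-> ->].
move=> tz tz'; have fz u : u \in zero_tails -> filter (fun x => x.1 == 0) u = u.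
  by rewrite !inE => /or4P[]/eqP->.
move=> e; have := congr1 (filter (fun x : entry => x.1 == 0)) e.
rewrite !filter_cat (fz t) // (fz t') // !filter_map.
rewrite !(eq_filter (_ : preim shift_entry _ =1 pred0)) // !filter_pred0 /= => tt.
have ss : size s = size s'.
  by move: (congr1 size e); rewrite !size_cat tt !size_map; lia.
split=> //; move: e => /eqP; rewrite tt eqseq_cat ?size_map //.
by rewrite eqxx andbT => /eqP/(inj_map shift_inj).
Qed.

(** The entries of value zero form one of four possible tails; lowering the
    other entries by one leaves a row of smaller weight. *)
Lemma rows_rec r m : size (rows r.+1 m) =
  sumn [seq if (size t <= r.+1) && (r.+1 - size t <= m)
            then size (rows (r.+1 - size t) (m - (r.+1 - size t))) else 0
       | t <- zero_tails].
Proof.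
pose M (t : seq entry) := if (size t <= r.+1) && (r.+1 - size t <= m)
  then rows (r.+1 - size t) (m - (r.+1 - size t)) else [::].
pose f (t s : seq entry) := map shift_entry s ++ t.
have -> : [seq if (size t <= r.+1) && (r.+1 - size t <= m)
            then size (rows (r.+1 - size t) (m - (r.+1 - size t))) else 0
       | t <- zero_tails] = [seq size (M t) | t <- zero_tails].
  by apply: eq_map => t; rewrite /M; case: ifP.
rewrite -(size_allpairs_dep f); apply/perm_size/uniq_perm.
- exact: rows_uniq.
- apply: allpairs_uniq_dep => //.
    by move=> t _; rewrite /M; case: ifP => // _; apply: rows_uniq.
  move=> [t s] [t' s'] /allpairsPdep[t1 [s1 [tz _ [-> _]]]].
  move=> /allpairsPdep[t2 [s2 [tz' _ [-> _]]]] /= /(shift_cat_inj tz tz')[-> tt].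
  by rewrite tt.
move=> s; rewrite mem_rows; apply/and3P/allpairsPdep.
  case=> /eqP sr sd /eqP sm; have [s' [t tz sE] _] := decreasing_split sd.
  exists t, s'; split=> //; rewrite /M.
  have t0 : row_sum t = 0.
    by move: tz; rewrite !inE /row_sum => /or4P[]/eqP->; rewrite unlock.
  move: sd; rewrite sE decreasing_shift // => sd.
  rewrite sE row_sum_cat row_sum_shift t0 in sm.
  rewrite sE size_cat size_map in sr.
  have -> : (size t <= r.+1) && (r.+1 - size t <= m) by lia.
  by rewrite mem_rows sd /= -sr addnK -sm addn0 addnK !eqxx.
move=> [t [s' [tz]]]; rewrite /M; case: ifP => // /andP[tr rm].
rewrite mem_rows => /and3P[/eqP sr sd /eqP sm] ->.
have t0 : row_sum t = 0.
  by move: tz; rewrite !inE /row_sum => /or4P[]/eqP->; rewrite unlock.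
rewrite /f decreasing_shift // row_sum_cat row_sum_shift t0 size_cat size_map.
by rewrite addn0 sm sr !subnK // !eqxx.
Qed.

Lemma size_rows0 m : size (rows 0 m) = (m == 0).
Proof.
case: m => [|m] /=.
  have /perm_size -> // : perm_eq (rows 0 0) [:: [::]].
  apply: uniq_perm => // [|s]; first exact: rows_uniq.
  rewrite mem_rows inE; case: s => //=.
  by rewrite /row_sum big_nil.
have -> // : rows 0 m.+1 = [::].
apply/eqP; rewrite -size_eq0 -leqn0 leqNgt -has_predT; apply/hasPn => s.
rewrite mem_rows => /and3P[/eqP/size0nil -> _].
by rewrite /row_sum big_nil.
Qed.

Lemma cphi2_nat_rows n : cphi2_nat n =
  \sum_(r < n.+1) \sum_(m < (n - r).+1)
     size (rows r m) * size (rows r (n - r - m)).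
Proof.
pose P r m := [seq (x, y) | x <- rows r m, y <- rows r (n - r - m)].
pose L r := [seq p | m <- iota 0 (n - r).+1, p <- P r m].
have memP r m (p : seq entry * seq entry) : m <= n - r -> r <= n ->
    (p \in P r m) =
    [&& size p.1 == r, row_sum p.1 == m & is_Fpartition2 n p].
  move=> mr rn; apply/allpairsP/and3P.
    case=> -[x y] [/= xr yr ->] /=; move: xr yr; rewrite !mem_rows /is_Fpartition2.
    move=> /and3P[/eqP sx dx /eqP hx] /and3P[/eqP sy dy /eqP hy] /=.
    by rewrite dx dy sx sy hx hy; split=> //; rewrite eqxx /=; apply/eqP; lia.
  case=> /eqP sr /eqP sm /and4P[/eqP s12 d1 d2 /eqP hn].
  exists p; rewrite !mem_rows d1 d2 -s12 sr sm !eqxx /=.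
  by split=> //; [rewrite -hn sr sm -addnA !addKn eqxx | case: (p)].
have memL r (p : seq entry * seq entry) : r <= n -> (p \in L r) =
    (size p.1 == r) && is_Fpartition2 n p.
  move=> rn; apply/allpairsPdep/andP.
    case=> m [q []]; rewrite mem_iota => mr; rewrite memP //.
    by move=> /and3P[? ? ?] ->.
  case=> sr pF; exists (row_sum p.1), p.
  have /and4P[_ _ _ /eqP hn] := pF.
  rewrite memP ?sr ?pF ?eqxx //; last by lia.
  by split=> //; rewrite mem_iota; lia.
rewrite (@cphi2_natE n [seq p | r <- iota 0 n.+1, p <- L r]).
- rewrite size_allpairs_dep sumnE big_map.
  rewrite -[X in iota _ X]subn0 -/(index_iota 0 n.+1) big_mkord.
  apply: eq_bigr => r _ /=; rewrite size_allpairs_dep sumnE big_map.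
  rewrite -[X in iota _ X]subn0 -/(index_iota 0 (n - r).+1) big_mkord.
  by apply: eq_bigr => m _ /=; rewrite size_allpairs.
- apply: allpairs_uniq_dep => [|r|]; first exact: iota_uniq.
    rewrite mem_iota => rn; apply: allpairs_uniq_dep => [|m _|].
    + exact: iota_uniq.
    + apply: allpairs_uniq; [exact: rows_uniq | exact: rows_uniq |].
      by move=> [x y] [x' y'].
    move=> [m p] [m' p'] /allpairsPdep[m1 [p1 [m1r p1P [-> ->]]]].
    move=> /allpairsPdep[m2 [p2 [m2r p2P [-> ->]]]] /= p12.
    move: m1r m2r p1P p2P; rewrite !mem_iota p12 => m1r m2r.
    rewrite !memP; try lia.
    by case/and3P=> _ /eqP <- _ /and3P[_ /eqP <- _].
  move=> [r p] [r' p'] /allpairsPdep[r1 [p1 [r1n p1P [-> ->]]]].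
  move=> /allpairsPdep[r2 [p2 [r2n p2P [-> ->]]]] /= p12.
  move: r1n r2n p1P p2P; rewrite !mem_iota p12 => r1n r2n.
  rewrite !memL; try lia.
  by case/andP=> /eqP <- _ /andP[/eqP <- _].
move=> p; apply/allpairsPdep/idP => [[r [q []]]|pF].
  rewrite mem_iota => rn; rewrite memL; last by lia.
  by case/andP=> _ ? ->.
have /and4P[_ _ _ /eqP hn] := pF.
have pn : size p.1 <= n by rewrite -hn -addnA leq_addr.
by exists (size p.1), p; rewrite memL ?eqxx ?pF ?mem_iota.
Qed.

End Rows.

(** * The generating function of 2-colored F-partitions *)

Section Summation.
Variable K : fieldType.
Implicit Types (f g : fps K) (F G : nat -> fps K).

Definition vanish_below k f := forall n, (n < k)%N -> f n = 0.

Lemma vanish_below_qX k f : vanish_below k (qvar K ^+ k * f).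
Proof. by move=> n nk; rewrite qvarXME leqNgt nk. Qed.

Lemma vanish_belowMr k f g : vanish_below k f -> vanish_below k (f * g).
Proof.
move=> fk n nk; rewrite fpsME big1 // => i _; rewrite fk ?mul0r //.
by apply: leq_ltn_trans nk; rewrite -ltnS.
Qed.

Lemma vanish_belowMl k f g : vanish_below k f -> vanish_below k (g * f).
Proof. by rewrite mulrC; apply: vanish_belowMr. Qed.

Lemma vanish_belowB k f g :
  vanish_below k f -> vanish_below k g -> vanish_below k (f - g).
Proof. by move=> fk gk n nk; rewrite fpsBE fk // gk // subrr. Qed.

Lemma vanish_below_le j k f : (j <= k)%N -> vanish_below k f -> vanish_below j f.
Proof. by move=> jk fk n nj; rewrite fk // (leq_trans nj). Qed.

(** The sum of a family whose r-th term starts at q^r or later. *)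
Definition fsum F : fps K :=
  locked_with fps_key (Fps (fun n => \sum_(r < n.+1) F r n)).

Lemma fsumE F n : fsum F n = \sum_(r < n.+1) F r n.
Proof. by rewrite /fsum locked_withE. Qed.

Definition summable F := forall r, vanish_below r (F r).

Lemma fsum_coef F M n : summable F -> (n < M)%N ->
  fsum F n = \sum_(r < M) F r n.
Proof.
move=> sF nM; rewrite fsumE -(subnKC nM) big_split_ord /= [X in _ = _ + X]big1 ?addr0 //.
by move=> i _; rewrite sF //= ltnS leq_addr.
Qed.

Lemma eq_fsum F G : F =1 G -> fsum F = fsum G.
Proof. by move=> FG; apply/fpsP => n; rewrite !fsumE; apply: eq_bigr => i _; rewrite FG. Qed.

Lemma fsumB F G : fsum (fun r => F r - G r) = fsum F - fsum G.
Proof. by apply/fpsP => n; rewrite fpsBE !fsumE -sumrB. Qed.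

Lemma fsumZ f F : summable F -> f * fsum F = fsum (fun r => f * F r).
Proof.
move=> sF; apply/fpsP => n; rewrite fpsME.
transitivity (\sum_(i < n.+1) \sum_(r < n.+1) f i * F r (n - i)%N).
  apply: eq_bigr => i _; rewrite (@fsum_coef _ n.+1) ?ltnS ?leq_subr //.
  by rewrite mulr_sumr.
by rewrite exchange_big fsumE; apply: eq_bigr => r _; rewrite fpsME.
Qed.

Lemma fsum_shift F : summable F -> F 0 = 0 -> fsum (fun r => F r.+1) = fsum F.
Proof.
move=> sF F0; apply/fpsP => n; rewrite (@fsum_coef F n.+2) //.
by rewrite fsumE [RHS]big_ord_recl F0 add0r.
Qed.

End Summation.

Section Products.
Variable K : fieldType.
Local Notation q := (qvar K).

(** These are the coefficients q^(i(i-1)/2) / ((1-q)...(1-q^i)) of Euler's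
    product (1+x)(1+xq)(1+xq^2)..., which counts strictly decreasing sequences
    by length and sum. *)
Fixpoint euler_coef i : fps K :=
  if i is j.+1 then q ^+ j * euler_coef j / (1 - q ^+ j.+1) else 1.
Local Notation a := euler_coef.

Lemma one_sub_qX_unit i : 1 - q ^+ i.+1 \is a GRing.unit.
Proof. by rewrite fps_unitE fpsBE fpsX0 /= expr0n subr0 oner_eq0. Qed.

Lemma euler_coefS i : (1 - q ^+ i.+1) * a i.+1 = q ^+ i * a i.
Proof. by rewrite mulrC divrK // one_sub_qX_unit. Qed.

Lemma euler_coef_order i : exists u, a i = q ^+ 'C(i, 2) * u.
Proof.
elim: i => [|i [u IH]]; first by exists 1; rewrite mulr1.
exists (u / (1 - q ^+ i.+1)).
by rewrite /= IH binS bin1 exprD -!mulrA mulrCA.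
Qed.

Lemma euler_coef_vanish i : vanish_below i.-1 (a i).
Proof.
have [u ->] := euler_coef_order i.
apply: vanish_below_le (vanish_below_qX _).
case: i => [|[|i]] //; rewrite binS bin1 /=; exact: leq_addl.
Qed.

Lemma euler_coef_vanish2 d s : vanish_below s (a s * a (s + d).+1).
Proof.
have [u ->] := euler_coef_order (s + d).+1.
apply/vanish_belowMl/(vanish_below_le _ (vanish_below_qX _)).
by rewrite binS bin1; lia.
Qed.

(** Series in x whose coefficients are series in q, so that [scale q] is the
    substitution of xq for x. *)
Definition euler_prod : fps (fps K) := Fps a.
Local Notation e := euler_prod.
Local Notation x := (qvar (fps K)).

Lemma euler_prod_rec : e = (1 + x) * scale q e.
Proof.
apply/fpsP => -[|i]; first by rewrite fpsM0 fpsDE /= mulr1 addr0 mul1r.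
rewrite mulrDl mul1r fpsDE qvarME /=.
have := euler_coefS i; rewrite mulrBl mul1r => /eqP.
by rewrite subr_eq addrC => /eqP.
Qed.

(** ** Rows *)

(** Each color contributes one factor e(x): in e(x)^2 = (1+x)^2 e(xq)^2 the factor
    (1+x)^2 stands for the four tails of [rows_rec] and the substitution of xq for
    x for the lowering of the other entries. *)
Lemma rowsE r m : (size (rows r m))%:R = (e * e) r m.
Proof.
have RE : e * e = (1 + x *+ 2 + x ^+ 2) * scale q (e * e).
  rewrite rmorphM /= {1 2}euler_prod_rec; ring.
have [N leN] := ubnP (r + m); elim: N => // N IH in r m leN *.
case: r leN => [|r] leN.
  by rewrite size_rows0 fpsM0 (_ : e 0 = 1) // mulr1 fps1E.
have rec k : ((1 + x *+ 2 + x ^+ 2) * scale q (e * e)) k.+1 m =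
    scale q (e * e) k.+1 m + (scale q (e * e) k m) *+ 2 +
    (if (0 < k)%N then scale q (e * e) k.-1 m else 0).
  have -> (Z : fps (fps K)) :
      (1 + x *+ 2 + x ^+ 2) * Z = Z + (x * Z + x * Z) + x ^+ 2 * Z by ring.
  rewrite !fpsDE qvarME mulr2n.
  by congr (_ + _); rewrite qvarXME ltnS; case: k => // k; rewrite subSS subn1.
have shiftE k : (k <= r.+1)%N -> (k + (m - k) < N)%N || ~~ (k <= m)%N ->
    (if (k <= m)%N then size (rows k (m - k)) else 0)%:R =
    scale q (e * e) k m.
  move=> kr kN; rewrite [RHS]qvarXME; case: ifP => [km|//].
  by rewrite IH //; rewrite km orbF in kN.
rewrite rows_rec RE rec -!shiftE; try lia.
rewrite /= !subn0 subn1 subSS subn1 /= !natrD mulr2n !addrA addr0.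
by case: r {leN IH rec shiftE}.
Qed.

Definition cphi_series : fps K := Fps (fun n => (cphi2_nat n)%:R).

Lemma cphi_seriesE :
  cphi_series = fsum (fun r => q ^+ r * ((e * e) r * (e * e) r)).
Proof.
apply/fpsP => n; rewrite -[LHS]/((cphi2_nat n)%:R) cphi2_nat_rows natr_sum fsumE.
apply: eq_bigr => r _; rewrite qvarXME -ltnS ltn_ord [RHS]fpsME natr_sum.
by apply: eq_bigr => m _; rewrite natrM !rowsE.
Qed.

(** ** Durfee rectangles *)

(** Up to a power of q, the series of the partitions, sorted by the size s of the
    largest s by (s + d) rectangle in the Young diagram. *)
Definition durfee d : fps K := fsum (fun s => q ^+ s * (a s * a (s + d)%N)).
Local Notation B := durfee.

Lemma summable_durfee d : summable (fun s => q ^+ s * (a s * a (s + d)%N)).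
Proof. by move=> s; apply: vanish_below_qX. Qed.

Lemma durfee_vanish d : vanish_below d.-1 (B d).
Proof.
move=> n nd; rewrite fsumE big1 // => s _.
apply: vanish_belowMl nd; apply: vanish_belowMl.
by apply: vanish_below_le (@euler_coef_vanish (s + d)); lia.
Qed.

Lemma durfee_alternate d :
  q ^+ d * B d - B d.+1 = - (q ^+ d.+1 * B d.+1 - B d.+2).
Proof.
pose F s := a s * a (s + d).+1.
have sF : summable F by move=> s; apply: euler_coef_vanish2.
have sqF (f : nat -> fps K) : summable (fun s => f s * F s).
  by move=> s; apply/vanish_belowMl/sF.
have E1 : q ^+ d * B d = fsum (fun s => (1 - q ^+ (s + d).+1) * F s).
  rewrite fsumZ; last exact: summable_durfee.
  apply: eq_fsum => s; transitivity (a s * (q ^+ (s + d) * a (s + d)%N)).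
    by rewrite exprD; ring.
  by rewrite -euler_coefS /F; ring.
have E2 : B d.+2 = fsum (fun s => (1 - q ^+ s) * F s).
  rewrite -fsum_shift //; last by rewrite expr0 subrr mul0r.
  apply: eq_fsum => s; transitivity (q ^+ s * a s * a (s + d).+2).
    by rewrite !addnS mulrA.
  by rewrite -euler_coefS /F addSn; ring.
have E3 : q ^+ d.+1 * B d.+1 = fsum (fun s => q ^+ (s + d).+1 * F s).
  rewrite fsumZ; last exact: summable_durfee.
  by apply: eq_fsum => s; rewrite /F addnS -addnS exprD; ring.
have E4 : B d.+1 = fsum (fun s => q ^+ s * F s).
  by apply: eq_fsum => s; rewrite /F addnS.
rewrite E1 E2 E3 [in LHS]E4 opprB -!fsumB.
by apply: eq_fsum => s; ring.
Qed.

(** By [durfee_alternate] the difference of the two sides is, up to sign, the same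
    for d + k as for d; but it starts at a power of q that grows with k. *)
Lemma durfeeS d : B d.+1 = q ^+ d * B d.
Proof.
suff x0 d' n : (q ^+ d' * B d' - B d'.+1) n = 0.
  by apply/esym/eqP; rewrite -subr_eq0; apply/eqP/fpsP => n; rewrite x0.
have alt k : q ^+ d' * B d' - B d'.+1 =
    (-1) ^+ k * (q ^+ (d' + k) * B (d' + k)%N - B (d' + k).+1).
  elim: k => [|k ->]; first by rewrite addn0 mul1r.
  by rewrite durfee_alternate addnS [(-1) ^+ k.+1]exprSr mulrN1 mulNr mulrN.
rewrite (alt n.+2).
apply: (@vanish_belowMl _ n.+1) => //; apply: vanish_belowB.
  by apply: vanish_below_le (vanish_below_qX _); lia.
by apply: vanish_below_le (@durfee_vanish _); lia.
Qed.

Lemma durfeeE d : B d = q ^+ 'C(d, 2) * B 0.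
Proof.
elim: d => [|d IH]; first by rewrite mul1r.
by rewrite durfeeS IH mulrA -exprD binS bin1 addnC.
Qed.

(** By Durfee's theorem, the inverse of (1-q)(1-q^2)(1-q^3)... *)
Definition partition_series : fps K := B 0.

Lemma partition_series0 : partition_series 0 = 1.
Proof. by rewrite /partition_series fsumE big_ord1 mul1r mul1r. Qed.
Local Notation p := partition_series.

End Products.

(** The terms of index d and - d together, in the sum of rho^|d| q^(d^2) over
    all integers d. *)
Definition theta_term (K : fieldType) (rho : fps K) d : fps K :=
  (if d == 0 then 1 else rho ^+ d *+ 2) * qvar K ^+ (d ^ 2).

HB.lock Definition theta (K : fieldType) (c : K) : fps K :=
  fsum (theta_term (fpsC c)).

Section ThetaRows.
Variable K : fieldType.
Local Notation q := (qvar K).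
Local Notation a := (@euler_coef K).
Local Notation e := (euler_prod K).
Local Notation x := (qvar (fps K)).
Local Notation B := (@durfee K).
Local Notation p := (partition_series K).

Lemma summable_theta (rho : fps K) : summable (theta_term rho).
Proof.
move=> d; apply: vanish_belowMl; rewrite -[_ ^+ _]mulr1.
by apply: vanish_below_le (vanish_below_qX _); case: d => // d; rewrite expnS leq_pmulr.
Qed.

Lemma sum_prod4 (R : comNzRingType) (D I : finType) (c : D -> R)
    (A A' : D -> I -> I -> R) :
  \sum_d c d * ((\sum_i \sum_j A d i j) * (\sum_i \sum_j A' d i j)) =
  \sum_i \sum_j \sum_k \sum_l \sum_d c d * (A d i j * A' d k l).
Proof.
rewrite [RHS](eq_bigr (fun i => \sum_d \sum_j \sum_k \sum_l
  c d * (A d i j * A' d k l))) => [|i _].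
  rewrite exchange_big; apply: eq_bigr => d _ /=.
  rewrite mulr_suml mulr_sumr; apply: eq_bigr => i _.
  rewrite mulr_suml mulr_sumr; apply: eq_bigr => j _.
  rewrite !mulr_sumr; apply: eq_bigr => k _.
  by rewrite !mulr_sumr.
rewrite [RHS]exchange_big; apply: eq_bigr => j _ /=.
rewrite [RHS]exchange_big; apply: eq_bigr => k _ /=.
by rewrite [RHS]exchange_big.
Qed.

(** The constant term in x of (e(xq) e(1/x)) (e(rho x q) e(rho/x)), grouped in
    two ways.  The four summation indices are truncated to at most M, which does
    not affect the coefficients of q^n for n < M. *)
Lemma theta_rows (c : K) (rho := fpsC c) : c * c = 1 ->
  fsum (fun r => q ^+ r * ((e * scale rho e) r * (e * scale rho e) r)) =
  p ^+ 2 * theta c.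
Proof.
move=> c2; have rho2 : rho * rho = 1 by rewrite -rmorphM c2 rmorph1.
rewrite theta.unlock -/rho; move: rho rho2 => rho rho2 {c c2}.
apply/fpsP => n; pose M := n.+2.
pose f (r : nat) := \sum_(i < M) \sum_(j < M) (r == i + j)%N%:R * (rho ^+ j * (a i * a j)).
pose T (d : nat) := \sum_(i < M) \sum_(j < M) (j == i + d :> nat)%N%:R * (q ^+ i * (a i * a j)).
pose S := \sum_(i < M) \sum_(j < M) \sum_(k < M) \sum_(l < M)
  (i + j == k + l)%N%:R *
  (q ^+ i * q ^+ j * (rho ^+ j * rho ^+ l) * (a i * a j * (a k * a l))).
have S_rows : S = \sum_(r < M + M) q ^+ r * (f r * f r).
  rewrite sum_prod4; apply: eq_bigr => i _; apply: eq_bigr => j _.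
  apply: eq_bigr => k _; apply: eq_bigr => l _.
  have ij : (i + j < M + M)%N by rewrite -addSn leq_add // ltnW.
  rewrite [RHS](bigD1 (Ordinal ij)) //= eqxx mul1r big1 ?addr0 => [|r].
    by rewrite exprD; ring.
  by rewrite -val_eqE /= => /negPf ->; rewrite !mul0r mulr0.
pose g (d : nat) := (if d == 0 then 1 else rho ^+ d *+ 2) * q ^+ d.
have rhoX i d : rho ^+ i * rho ^+ (i + d) = rho ^+ d.
  by rewrite exprD mulrA -exprMn rho2 expr1n mul1r.
have S_rect : S = \sum_(d < M) g d * (T d * T d).
  pose U (d : nat) := \sum_(i < M) \sum_(k < M)
    (i == k + d :> nat)%N%:R * (q ^+ i * (a i * a k)).
  pose V (d : nat) := \sum_(j < M) \sum_(l < M)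
    (l == j + d :> nat)%N%:R * (q ^+ j * (rho ^+ j * rho ^+ l) * (a j * a l)).
  pose W (d : nat) := \sum_(j < M) \sum_(l < M)
    (j == l + d :> nat)%N%:R * (q ^+ j * (rho ^+ j * rho ^+ l) * (a j * a l)).
  have UE d : U d = q ^+ d * T d.
    rewrite /U exchange_big mulr_sumr; apply: eq_bigr => k _.
    rewrite mulr_sumr; apply: eq_bigr => i _.
    by case: eqP => [->|_]; rewrite ?mul0r ?mulr0 // exprD; ring.
  have VE d : V d = rho ^+ d * T d.
    rewrite mulr_sumr; apply: eq_bigr => j _.
    rewrite mulr_sumr; apply: eq_bigr => l _.
    by case: eqP => [->|_]; rewrite ?mul0r ?mulr0 // rhoX; ring.
  have WE d : W d = rho ^+ d * q ^+ d * T d.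
    rewrite /W exchange_big mulr_sumr; apply: eq_bigr => l _.
    rewrite mulr_sumr; apply: eq_bigr => j _.
    case: eqP => [->|_]; rewrite ?mul0r ?mulr0 //.
    by rewrite [rho ^+ (_ + _) * _]mulrC rhoX exprD; ring.
  have -> : \sum_(d < M) g d * (T d * T d) =
      \sum_(d < M) 1 * (U d * V d) + \sum_(d < M) (d != 0 :> nat)%:R * (T d * W d).
    rewrite -big_split; apply: eq_bigr => d _ /=.
    rewrite UE VE WE /g; case: (nat_of_ord d) => [|d'] /=.
      by rewrite !expr0; ring.
    by ring.
  rewrite !sum_prod4 -big_split; apply: eq_bigr => i _ /=.
  rewrite exchange_big -big_split; apply: eq_bigr => k _ /=.
  rewrite -big_split; apply: eq_bigr => j _ /=.
  rewrite -big_split; apply: eq_bigr => l _ /=.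
  have [ki|ik] := leqP k i.
    have dM : (i - k < M)%N by apply: leq_ltn_trans (leq_subr _ _) _.
    rewrite [X in _ + X]big1 ?addr0 => [|d _]; last first.
      case: eqP => [_|d0]; first by rewrite mul0r.
      by case: eqP => [?|_]; [lia | rewrite !(mul0r, mulr0)].
    rewrite (bigD1 (Ordinal dM)) //= [X in _ + X]big1 ?addr0 => [|d].
      have -> : (i == k + (i - k) :> nat)%N by rewrite subnKC.
      have -> : (l == j + (i - k) :> nat)%N = (i + j == k + l)%N by lia.
      by rewrite /=; ring.
    rewrite -val_eqE /= => dik.
    by case: eqP => [?|_]; [lia | rewrite !(mul0r, mulr0)].
  have dM : (k - i < M)%N by apply: leq_ltn_trans (leq_subr _ _) _.
  rewrite [X in X + _]big1 ?add0r => [|d _]; last first.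
    by case: eqP => [?|_]; [lia | rewrite !(mul0r, mulr0)].
  rewrite (bigD1 (Ordinal dM)) //= [X in _ + X]big1 ?addr0 => [|d].
    have -> : (k == i + (k - i) :> nat)%N by rewrite subnKC // ltnW.
    have -> : (j == l + (k - i) :> nat)%N = (i + j == k + l)%N by lia.
    have -> : (k - i != 0)%N by lia.
    by rewrite /=; ring.
  rewrite -val_eqE /= => dik; rewrite (_ : (k == i + d :> nat)%N = false) ?(mul0r, mulr0) //.
  by lia.
have fE (r : nat) : (r < M)%N -> f r = (e * scale rho e) r.
  move=> rM; rewrite /f fpsME (big_ord_widen M (fun i => a i * scale rho e (r - i)%N)) //.
  rewrite [RHS]big_mkcond; apply: eq_bigr => i _ /=; rewrite ltnS.
  case: leqP => [ir|ri]; last first.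
    by rewrite big1 // => j _; case: eqP => [?|_]; [lia | rewrite mul0r].
  have jM : (r - i < M)%N by apply: leq_ltn_trans (leq_subr _ _) _.
  rewrite (bigD1 (Ordinal jM)) //= subnKC // eqxx big1 ?addr0 => [|j].
    by rewrite mul1r mulrCA.
  by rewrite -val_eqE /= => ji; case: eqP => [?|_]; [lia | rewrite mul0r].
have TE d m : (m <= n)%N -> T d m = B d m.
  move=> mn; rewrite (@fsum_coef _ _ M) ?ltnS ?(leqW mn) //; last first.
    exact: summable_durfee.
  rewrite fps_sumE; apply: eq_bigr => i _.
  have [idM|Mid] := ltnP (i + d) M.
    congr (fcoef _ m); rewrite (bigD1 (Ordinal idM)) //= eqxx mul1r big1 ?addr0 // => j.
    by rewrite -val_eqE /= => /negPf->; rewrite mul0r.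
  rewrite big1 => [|j _].
    rewrite fps0E; apply/esym; apply: (vanish_belowMl _ (vanish_belowMl _ _)).
      exact: euler_coef_vanish.
    by lia.
  by have := ltn_ord j; case: eqP => [?|_ _]; [lia | rewrite mul0r].
transitivity (S n).
  rewrite S_rows fps_sumE -(@fsum_coef _ (fun r => q ^+ r * (f r * f r)) (M + M) n).
  - by rewrite !fsumE; apply: eq_bigr => i _; rewrite fE // ltnW // ltnS.
  - by move=> r; apply: vanish_below_qX.
  by lia.
have eqMr (u v w : fps K) : (forall m, (m <= n)%N -> v m = w m) ->
    forall m, (m <= n)%N -> (u * v) m = (u * w) m.
  move=> vw m mn; rewrite !fpsME; apply: eq_bigr => i _; rewrite vw //.
  by apply: leq_trans mn; apply: leq_subr.
rewrite S_rect fps_sumE fsumZ; last exact: summable_theta.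
rewrite (@fsum_coef _ _ M) //; last first.
  by move=> r; apply/vanish_belowMl/summable_theta.
apply: eq_bigr => d _.
transitivity ((g d * (B d * B d)) n).
  apply: (@eqMr (g d)) (leqnn n) => m mn.
  transitivity ((T d * B d) m).
    by apply: (@eqMr (T d)) mn => k kn; apply: TE.
  rewrite mulrC.
  by apply: (@eqMr (B d)) mn => k kn; apply: TE.
rewrite durfeeE -/p /g /theta_term; congr (fcoef _ n).
have -> : (d ^ 2 = d + 'C(d, 2) + 'C(d, 2))%N.
  by elim: (nat_of_ord d) => // k IH; rewrite binS bin1; lia.
rewrite !exprD; move: (if _ then _ else _) (B 0) (q ^+ d) => c P Q.
by rewrite expr2; ring.
Qed.

(** The case of two colors of Andrews' formula for the generating function of
    colored F-partitions. *)
Lemma cphi_series_theta : cphi_series K = p ^+ 2 * theta 1.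
Proof.
rewrite -theta_rows ?mul1r // cphi_seriesE; apply: eq_fsum => r.
have -> : scale (fpsC 1) e = e.
  by rewrite rmorph1; apply/fpsP => i /=; rewrite expr1n mul1r.
by [].
Qed.

Arguments euler_coef : simpl never.

Lemma dil_qX k : dil (q ^+ k) = q ^+ k.*2.
Proof.
apply/fpsP => i; rewrite /= !qvarXE; have [oi|ei] := boolP (odd i).
  by case: eqP => // ik; rewrite ik odd_double in oi.
by have := even_halfK ei; case: eqP => ik; case: eqP => ih //; lia.
Qed.

(** Euler's product at x times Euler's product at -x is the one at q^2, -x^2. *)
Lemma euler_prod_opp k :
  (e * scale (-1) e) k.*2 = (-1) ^+ k * dil (a k) /\
  (e * scale (-1) e) k.*2.+1 = 0.
Proof.
pose f := e * scale (-1) e.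
have scale_x : scale (-1) x = - x.
  by apply/fpsP => -[|[|i]] /=; rewrite ?mulr0 ?mulr1 ?expr1 ?oppr0.
have scaleC : scale (-1) (scale q e) = scale q (scale (-1) e).
  by apply/fpsP => i /=; rewrite mulrCA.
have fE : f = scale q f - x ^+ 2 * scale q f.
  rewrite /f rmorphM /= {1 2}euler_prod_rec rmorphM rmorphD rmorph1 /= scale_x scaleC.
  by ring.
have one i : (1 - q ^+ i.+1) * f i.+1 = - (if i is j.+1 then q ^+ j * f j else 0).
  rewrite mulrBl mul1r {1}fE fpsBE qvarXME subSS subn1.
  by case: i => [|i] /=; rewrite ?subr0 ?oppr0 ?subrr // addrAC subrr add0r.
have cancel i (u v : fps K) : (1 - q ^+ i.+1) * u = (1 - q ^+ i.+1) * v -> u = v.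
  exact/mulrI/one_sub_qX_unit.
rewrite -/f; elim: k => [|k [IHe IHo]].
  split; last by apply: (cancel 0); rewrite one mulr0 oppr0.
  by rewrite /f fpsM0 /= rmorph1 expr0 !mul1r.
rewrite doubleS; split; last first.
  by apply: (cancel k.*2.+2); rewrite one IHo !mulr0 oppr0.
apply: (cancel k.*2.+1); rewrite one IHe -doubleS -!dil_qX.
have := congr1 (@dil K) (euler_coefS K k).
by rewrite !rmorphM rmorphB rmorph1 /= => qk; rewrite [RHS]mulrCA qk exprS; ring.
Qed.

(** [theta_rows] at rho = -1: by [euler_prod_opp] only the even r contribute, and
    they form the dilation of the sum q^k a_k^2 that defines p. *)
Lemma dil_partition_series : dil p = p ^+ 2 * theta (-1).
Proof.
rewrite -theta_rows ?mulN1r ?opprK // rmorphN1; apply/fpsP => n.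
have opp k := euler_prod_opp k.
have [on|en] := boolP (odd n).
  rewrite dil_odd // fsumE big1 // => r _.
  have [rk|rk] : r = r./2.*2.+1 :> nat \/ r = r./2.*2 :> nat by lia.
    by rewrite rk (opp _).2 !mulr0.
  rewrite rk (opp _).1 mulrACA -expr2 sqrr_sign mul1r -dil_qX -!rmorphM.
  exact: dil_odd.
have nE := even_halfK en; rewrite -nE dil_double fsumE.
pose G := (fun r : nat => q ^+ r * ((e * scale (-1) e) r * (e * scale (-1) e) r)).
rewrite (@fsum_coef _ G n./2.+1.*2); first last.
  - by lia.
  - by move=> r; apply: vanish_below_qX.
have pair m : \sum_(r < m.*2) G r n./2.*2 = \sum_(k < m) (G k.*2 + G k.*2.+1) n./2.*2.
  elim: m => [|m IH]; first by rewrite !big_ord0.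
  by rewrite doubleS !big_ord_recr IH -[LHS]addrA.
rewrite pair; apply: eq_bigr => k _.
rewrite fpsDE /G !(opp _).2 mulr0 mulr0 addr0 (opp _).1.
rewrite mulrACA -expr2 sqrr_sign mul1r -dil_qX -!rmorphM.
by rewrite -[RHS]/(dil _ _) dil_double addn0.
Qed.

End ThetaRows.

(** * Sums of two squares *)

Section SumsOfSquares.

Definition int_range (N : nat) : seq int :=
  [seq Posz i | i <- iota 0 N.+1] ++ [seq Negz i | i <- iota 0 N].

Lemma mem_int_range N x : (x \in int_range N) = (`|x| <= N)%N.
Proof.
rewrite mem_cat; apply/orP/idP => [[] /mapP[i]|].
- by rewrite mem_iota => iN ->; lia.
- by rewrite mem_iota => iN ->; lia.
case: x => i iN; [left|right]; apply/mapP; exists i; rewrite ?mem_iota //; lia.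
Qed.

Lemma int_range_uniq N : uniq (int_range N).
Proof.
rewrite cat_uniq !map_inj_uniq ?iota_uniq //=; try by move=> i j [].
by rewrite andbT; apply/hasPn => _ /mapP[i _ ->]; apply/mapP => -[].
Qed.

Definition two_squares N n : seq (int * int) :=
  [seq v <- [seq (x, y) | x <- int_range N, y <- int_range N]
  | (`|v.1| ^ 2 + `|v.2| ^ 2 == n)%N].

Lemma mem_two_squares N n v : (n <= N)%N ->
  (v \in two_squares N n) = (`|v.1| ^ 2 + `|v.2| ^ 2 == n)%N.
Proof.
move=> nN; rewrite mem_filter; apply/andP/idP => [[]//|vn]; split; first exact: vn.
apply/allpairsP; exists v; move/eqP: vn; rewrite !mem_int_range.
by case: v => x y /= xyn; split=> //; nia.
Qed.

Lemma two_squares_uniq N n : uniq (two_squares N n).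
Proof.
apply/filter_uniq/allpairs_uniq; try exact: int_range_uniq.
by move=> [x y] [x' y'].
Qed.

(** A representation 2n = x^2 + y^2 has x and y of the same parity, so that
    x = r + s and y = r - s with r^2 + s^2 = n. *)
Lemma two_squares_double N n : (n.*2 <= N)%N ->
  perm_eq (two_squares N n.*2)
          [seq (v.1 + v.2, v.1 - v.2) | v <- two_squares N n].
Proof.
move=> nN; have nN' : (n <= N)%N by rewrite -addnn in nN; lia.
apply: uniq_perm; first exact: two_squares_uniq.
  rewrite map_inj_uniq ?two_squares_uniq // => -[r s] [r' s'] /= [e1 e2].
  by congr (_, _); lia.
move=> [x y]; rewrite mem_two_squares //=; apply/eqP/mapP.
  move=> xy; have [r [s [xE yE]]] : exists r s, x = r + s /\ y = r - s.
    exists ((x + y) %/ 2)%Z, ((x - y) %/ 2)%Z.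
    have : odd (`|x| ^ 2 + `|y| ^ 2) = false by rewrite xy odd_double.
    rewrite oddD !oddX /=; lia.
  exists (r, s); rewrite ?mem_two_squares //= ?xE ?yE //.
  by apply/eqP; move: xy; rewrite xE yE -muln2; nia.
move=> [[r s]]; rewrite mem_two_squares //= => /eqP <- [-> ->]; rewrite -muln2.
by nia.
Qed.

Variable K : fieldType.
Local Notation sign c x := (c ^+ absz x).

Lemma theta_coef (c : K) N n : (n <= N)%N ->
  theta c n = \sum_(x <- int_range N | (`|x| ^ 2 == n)%N) sign c x.
Proof.
move=> nN; rewrite theta.unlock (@fsum_coef _ _ N.+1) //; last exact: summable_theta.
rewrite big_cat !big_map -[N.+1 in RHS]subn0 -[iota 0 N]/(iota 0 (0 + N)).
rewrite -[in X in _ = _ + X](subn0 N) -/(index_iota 0 N.+1) -/(index_iota 0 N).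
rewrite !big_mkord [X in _ = X + _]big_mkcond [X in _ = _ + X]big_mkcond.
rewrite !big_ord_recl -[RHS]addrA -big_split; congr (_ + _).
  rewrite (_ : theta_term _ _ = 1); last by rewrite /theta_term /= mulr1.
  by rewrite fps1E; case: n {nN} => [|[]].
apply: eq_bigr => i _.
rewrite (_ : theta_term _ _ = fpsC (c ^+ i.+1 *+ 2) * qvar K ^+ (i.+1 ^ 2)); last first.
  by rewrite rmorphMn rmorphXn.
rewrite fpsCME qvarXE [n == _]eq_sym /=; case: eqP => _; rewrite ?mulr0 ?addr0 //.
by rewrite mulr1 mulr2n.
Qed.

Lemma thetaM_coef (c d : K) n : (theta c * theta d) n =
  \sum_(v <- two_squares n n) sign c v.1 * sign d v.2.
Proof.
rewrite big_filter big_mkcond big_allpairs_dep fpsME.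
transitivity (\sum_(i < n.+1) \sum_(x <- int_range n) \sum_(y <- int_range n)
    (if (`|x| ^ 2 == i)%N then sign c x else 0) *
    (if (`|y| ^ 2 == n - i)%N then sign d y else 0)).
  apply: eq_bigr => i _; have iN : (i <= n)%N by rewrite -ltnS.
  rewrite (theta_coef c iN) (theta_coef d (leq_subr i n)).
  by rewrite !(big_mkcond (fun _ => _ == _)) big_distrlr.
rewrite exchange_big; apply: eq_bigr => x _ /=.
rewrite exchange_big; apply: eq_bigr => y _ /=.
have [xn|nx] := leqP (`|x| ^ 2) n.
  rewrite (bigD1 (inord (`|x| ^ 2)%N)) //= inordK ?ltnS // eqxx big1 ?addr0 => [|i ix].
    have -> : (`|y| ^ 2 == n - `|x| ^ 2)%N = (`|x| ^ 2 + `|y| ^ 2 == n)%N by lia.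
    by case: ifP; rewrite ?mulr0.
  case: eqP => [xi|_]; last by rewrite mul0r.
  by case/eqP: ix; apply: val_inj; rewrite /= inordK.
rewrite big1 => [|i _]; first by case: eqP => //; lia.
case: eqP => [xi|_]; last by rewrite mul0r.
by have := ltn_ord i; rewrite -xi; lia.
Qed.

Local Notation phi := (theta (1 : K)).
Local Notation psi := (theta (-1 : K)).

Let two_squares_widen n (F : int * int -> K) N : (n <= N)%N ->
  \sum_(v <- two_squares N n) F v = \sum_(v <- two_squares n n) F v.
Proof.
move=> nN; apply/perm_big/uniq_perm; try exact: two_squares_uniq.
by move=> v; rewrite !mem_two_squares.
Qed.

Let sum_two_squares_double n (F : int * int -> K) :
  \sum_(v <- two_squares n.*2 n.*2) F v =
  \sum_(v <- two_squares n n) F (v.1 + v.2, v.1 - v.2).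
Proof.
transitivity (\sum_(v <- two_squares n.*2 n) F (v.1 + v.2, v.1 - v.2)).
  by rewrite (perm_big _ (two_squares_double (leqnn _))) big_map.
have nn : (n <= n.*2)%N by rewrite -addnn leq_addr.
exact: (two_squares_widen _ nn).
Qed.

Lemma theta_sqr_sum : phi ^+ 2 + psi ^+ 2 = dil (phi ^+ 2) *+ 2.
Proof.
apply/fpsP => n; rewrite fpsDE !expr2 mulr2n fpsDE.
have [on|en] := boolP (odd n).
  rewrite dil_odd // addr0 !thetaM_coef -big_split /= big1_seq // => v.
  rewrite mem_two_squares // !expr1n mulr1 -exprD => /andP[_ /eqP vn].
  move: on; rewrite -vn oddD !oddX /= -oddD => on.
  by rewrite -signr_odd on expr1 subrr.
have nE := even_halfK en; rewrite -nE dil_double !thetaM_coef !sum_two_squares_double.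
rewrite -!big_split /=; apply: eq_bigr => v _.
rewrite !expr1n -exprD -[in (-1) ^+ _]signr_odd.
have -> : odd (`|(v.1 + v.2)%R| + `|(v.1 - v.2)%R|) = false by lia.
by rewrite expr0 mulr1.
Qed.

Lemma theta_mul : 2%:R != 0 :> K -> phi * psi = dil (psi ^+ 2).
Proof.
move=> n2; apply/fpsP => n; rewrite expr2.
have [on|en] := boolP (odd n).
  rewrite dil_odd //; apply: (mulfI n2); rewrite mulr0 mulr_natl mulr2n.
  rewrite {1}mulrC !thetaM_coef -big_split /= big1_seq // => v.
  rewrite mem_two_squares // !expr1n mulr1 mul1r => /andP[_ /eqP vn].
  rewrite -signr_odd -[(-1) ^+ absz v.2]signr_odd.
  move: on; rewrite -vn oddD !oddX /=.
  by do 2![case: odd] => // _; rewrite ?expr0 ?expr1 ?subrr ?addNr.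
have nE := even_halfK en; rewrite -nE dil_double !thetaM_coef.
rewrite sum_two_squares_double; apply: eq_bigr => v _ /=.
rewrite expr1n mul1r -exprD -signr_odd -[RHS]signr_odd; congr (_ ^+ _).
by congr nat_of_bool; case: v => r s /=; lia.
Qed.

End SumsOfSquares.

(** * The lambda function and the arithmetic-geometric mean *)

(** With q = exp(pi i tau), z and b are the squares of Jacobi's theta functions
    theta_3 and theta_4, and lambda is the modular lambda function. *)
HB.lock Definition zser (K : fieldType) : fps K := theta 1 ^+ 2.
HB.lock Definition bser (K : fieldType) : fps K := theta (-1) ^+ 2.
HB.lock Definition lambda (K : fieldType) : fps K :=
  1 - (bser K / zser K) ^+ 2.
HB.lock Definition kser (K : fieldType) : fps K :=
  (zser K - bser K) / (zser K + bser K).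

Section Lambda.
Variable K : fieldType.
Local Notation q := (qvar K).
Local Notation p := (partition_series K).
Local Notation phi := (theta (1 : K)).
Local Notation psi := (theta (-1 : K)).

Lemma theta_coef_lt5 (c : K) (n : nat) : (n < 5)%N ->
  theta c n = nth 0 [:: 1; c *+ 2; 0; 0; c ^+ 2 *+ 2] n.
Proof.
move=> n5; rewrite (@theta_coef _ _ 4) // /int_range /= !(big_cons, big_nil) /=.
by case: n n5 => [|[|[|[|[|]]]]] //= _; rewrite ?expr0 ?expr1 ?addr0 ?add0r ?mulr2n.
Qed.

Lemma phi_coef n : (n < 5)%N -> phi n = nth 0 [:: 1; 2%:R; 0; 0; 2%:R] n.
Proof.
move=> n5; rewrite theta_coef_lt5 //.
by case: n n5 => [|[|[|[|[|]]]]] //= _; rewrite ?expr1n.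
Qed.

Lemma psi_coef n : (n < 5)%N -> psi n = nth 0 [:: 1; - 2%:R; 0; 0; 2%:R] n.
Proof.
move=> n5; rewrite theta_coef_lt5 //.
by case: n n5 => [|[|[|[|[|]]]]] //= _; rewrite ?sqrrN ?expr1n // mulNrn.
Qed.

Local Notation z := (zser K).
Local Notation b := (bser K).
Local Notation k := (kser K).
Local Notation lambda := (lambda K).

Hypothesis two_neq0 : 2%:R != 0 :> K.

Lemma zser0 : z 0 = 1. Proof. by rewrite zser.unlock fpsX0 phi_coef // expr1n. Qed.
Lemma bser0 : b 0 = 1. Proof. by rewrite bser.unlock fpsX0 psi_coef // expr1n. Qed.
Lemma zser1 : z 1 = 4%:R.
Proof. by rewrite zser.unlock expr2 fpsM1 !phi_coef //=; ring. Qed.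
Lemma bser1 : b 1 = - 4%:R.
Proof. by rewrite bser.unlock expr2 fpsM1 !psi_coef //=; ring. Qed.

Lemma zser_unit : z \is a GRing.unit.
Proof. by rewrite fps_unitE zser0 oner_neq0. Qed.

Lemma zb_unit : z + b \is a GRing.unit.
Proof. by rewrite fps_unitE fpsDE zser0 bser0. Qed.

Lemma zser_neq0 : z != 0. Proof. by apply: contraTneq zser_unit => ->; rewrite unitr0. Qed.

Lemma dil_neq0 (f : fps K) : f 0 != 0 -> dil f != 0.
Proof. by move=> f0; apply: contraNneq f0 => /fpsP/(_ 0) /= ->. Qed.

Lemma two_fps_neq0 : 2%:R != 0 :> fps K.
Proof.
apply: contraNneq two_neq0 => /fpsP/(_ 0).
by rewrite fpsMn fps1E fps0E => ->.
Qed.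

(** (dil z, dil b) is one step of the arithmetic-geometric mean from (z, b). *)
Lemma agm_arith : z + b = dil z *+ 2.
Proof. by rewrite zser.unlock bser.unlock theta_sqr_sum. Qed.

Lemma agm_geom : z * b = dil b ^+ 2.
Proof. by rewrite zser.unlock bser.unlock -exprMn theta_mul. Qed.

Lemma one_sub_lambda : (1 - lambda) * z ^+ 2 = b ^+ 2.
Proof. by rewrite lambda.unlock opprB addrC subrK -exprMn divrK // zser_unit. Qed.

Lemma kserE : k * (z + b) = z - b.
Proof. by rewrite kser.unlock divrK // zb_unit. Qed.

Lemma dil_z_neq0 : dil z != 0.
Proof. by apply: dil_neq0; rewrite zser0 oner_neq0. Qed.

Lemma zser_landen : z = dil z * (1 + k).
Proof.
apply: (mulfI two_fps_neq0).
have -> : 2%:R * (dil z * (1 + k)) = dil z *+ 2 + k * (dil z *+ 2) by ring.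
by rewrite -agm_arith kserE; ring.
Qed.

Lemma lambda_z : lambda * z ^+ 2 = 4%:R * k * dil z ^+ 2.
Proof.
have -> : lambda * z ^+ 2 = z ^+ 2 - (1 - lambda) * z ^+ 2 by ring.
have -> : 4%:R * k * dil z ^+ 2 = k * (dil z *+ 2) * (dil z *+ 2) by ring.
by rewrite one_sub_lambda -agm_arith kserE; ring.
Qed.

Lemma lambda_landen : lambda * (1 + k) ^+ 2 = 4%:R * k.
Proof.
apply: (mulIf (expf_neq0 2 dil_z_neq0)).
by rewrite -mulrA -exprMn [(1 + k) * _]mulrC -zser_landen lambda_z.
Qed.

Lemma dil_lambda : dil lambda = k ^+ 2.
Proof.
apply: (mulIf (expf_neq0 2 dil_z_neq0)); apply: (mulfI (expf_neq0 2 two_fps_neq0)).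
have -> : dil lambda * dil z ^+ 2 = dil z ^+ 2 - dil b ^+ 2.
  by rewrite -rmorphXn -[dil b ^+ 2]rmorphXn -rmorphM -rmorphB /= -one_sub_lambda;
    congr dil; ring.
have -> : 2%:R ^+ 2 * (k ^+ 2 * dil z ^+ 2) = (k * (dil z *+ 2)) ^+ 2 by ring.
rewrite -agm_arith kserE -agm_geom.
have -> : 2%:R ^+ 2 * (dil z ^+ 2 - z * b) = (dil z *+ 2) ^+ 2 - 4%:R * (z * b) by ring.
by rewrite -agm_arith; ring.
Qed.

Lemma kser0 : k 0 = 0.
Proof. by rewrite kser.unlock fpsM0 fpsBE zser0 bser0 subrr mul0r. Qed.

Lemma kser1 : k 1 = 4%:R.
Proof.
apply: (mulIf two_neq0); have /fpsP/(_ 1) := kserE.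
rewrite fpsM1 fpsBE !fpsDE kser0 zser0 bser0 zser1 bser1 mul0r add0r => ->.
by ring.
Qed.

Lemma lambda0 : lambda 0 = 0.
Proof.
have /fpsP/(_ 0) := lambda_z.
by rewrite !fpsM0 zser0 kser0 !mulr1 mulr0 !mul0r.
Qed.

Lemma lambda1 : lambda 1 = 16%:R.
Proof.
have /fpsP/(_ 1) := lambda_landen; rewrite expr2.
have c4 : (4%:R * k) 1 = 16%:R.
  by rewrite -[4%:R](rmorph_nat (@fpsC K)) fpsCME kser1; ring.
by rewrite c4 fpsM1 lambda0 mul0r add0r fpsM0 fpsDE kser0 fps1E addr0 !mulr1.
Qed.

Lemma four_neq0 : 4%:R != 0 :> K.
Proof. by rewrite (natrM _ 2 2) mulf_neq0. Qed.

Lemma lambda_unif : lambda 1 != 0.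
Proof. by rewrite lambda1 (natrM _ 4 4) mulf_neq0 ?four_neq0. Qed.

(** Both sides of Jacobi's formula for the derivative of lambda transform in the
    same way under the Landen transformation. *)
Lemma eulerD_lambda : eulerD lambda = lambda * (1 - lambda) * z ^+ 2.
Proof.
apply/eqP; rewrite -subr_eq0; set delta := (_ - _).
have Dk : eulerD lambda * (1 + k) ^+ 3 = 4%:R * (1 - k) * eulerD k.
  have := congr1 (@eulerD K) lambda_landen.
  rewrite eulerDM eulerDX raddfD /= eulerD1 add0r -mulr_natl eulerDM.
  rewrite -[4%:R in RHS](rmorph_nat (@fpsC K)) eulerDC mul0r add0r rmorph_nat.
  move=> E; have {}E : eulerD lambda * (1 + k) ^+ 3 +
      lambda * (1 + k) ^+ 2 * (2%:R * eulerD k) = 4%:R * eulerD k * (1 + k).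
    by rewrite -E; ring.
  by move: E; rewrite lambda_landen => /(canRL (addrK _)) ->; ring.
have kDk : k * eulerD k = dil (eulerD lambda).
  apply: (mulfI two_fps_neq0); rewrite [RHS]mulr_natl -eulerD_dil dil_lambda.
  by rewrite eulerDX expr1 -mulr_natl; ring.
have lam4 : lambda * (1 - lambda) * (1 + k) ^+ 4 = 4%:R * k * (1 - k) ^+ 2.
  have -> : lambda * (1 - lambda) * (1 + k) ^+ 4 =
    lambda * (1 + k) ^+ 2 * ((1 + k) ^+ 2 - lambda * (1 + k) ^+ 2) by ring.
  by rewrite lambda_landen; ring.
have delta01 : delta 0 = 0 /\ delta 1 = 0.
  have l0 : (lambda * (1 - lambda)) 0 = 0 by rewrite fpsM0 lambda0 mul0r.
  have l1 : (lambda * (1 - lambda)) 1 = lambda 1.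
    by rewrite fpsM1 lambda0 mul0r add0r fpsBE fps1E lambda0 subr0 mulr1.
  rewrite /delta !fpsBE fpsM0 fpsM1 l0 l1 /= !mul0r subrr mul1r.
  by rewrite fpsX0 zser0 expr1n mulr1 add0r subrr.
apply/eqP/(@dil_contract K (k * (1 + k) ^+ 3) (4%:R * (1 - k))).
- by rewrite fpsM0 kser0 mul0r.
- rewrite fpsM1 kser0 mul0r add0r fpsX0 fpsDE kser0 addr0 expr1n mulr1 kser1.
  exact: four_neq0.
- by case: delta01.
- by case: delta01.
rewrite /delta rmorphB !rmorphM rmorphB rmorph1 /= dil_lambda -kDk.
rewrite mulrBr.
have -> : k * (1 + k) ^+ 3 * eulerD lambda = k * (eulerD lambda * (1 + k) ^+ 3) by ring.
have -> : k * (1 + k) ^+ 3 * (lambda * (1 - lambda) * z ^+ 2) =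
   k * (1 + k) * (lambda * (1 - lambda) * (1 + k) ^+ 4) * dil z ^+ 2.
  by rewrite {1}zser_landen; ring.
by rewrite Dk lam4; ring.
Qed.

(** With q = exp(pi i tau), this says lambda (1 - lambda)^4 z^12 = 16 eta(tau/2)^24.
    Each side is a series X with X^2 = 16 X(q^2), which is determined by its first
    coefficients. *)
Lemma partition_lambda : lambda * b ^+ 8 * z ^+ 4 * p ^+ 24 = 16%:R * q.
Proof.
set X := LHS; set Y := RHS.
have XX : X ^+ 2 = 16%:R * dil X.
  rewrite /X 3!rmorphM !rmorphXn /= dil_lambda dil_partition_series.
  have -> : 16%:R * (k ^+ 2 * dil b ^+ 8 * dil z ^+ 4 * (p ^+ 2 * psi) ^+ 24) =
    (4%:R * k * dil z ^+ 2) ^+ 2 * (dil b ^+ 2) ^+ 4 * p ^+ 48 * (psi ^+ 2) ^+ 12.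
    by ring.
  have psi_sqr : psi ^+ 2 = b by rewrite bser.unlock.
  by rewrite psi_sqr -lambda_z -agm_geom; ring.
have YY : Y ^+ 2 = 16%:R * dil Y.
  rewrite /Y rmorphM rmorph_nat /= -[qvar K in RHS]expr1 dil_qX; ring.
have XE : X = lambda * (b ^+ 8 * z ^+ 4 * p ^+ 24) by rewrite /X; ring.
have X0 : X 0 = 0 by rewrite XE fpsM0 lambda0 mul0r.
have X1 : X 1 = 16%:R.
  rewrite XE fpsM1 lambda0 mul0r add0r lambda1 2!fpsM0 !fpsX0.
  by rewrite bser0 zser0 partition_series0 !expr1n !mulr1.
have Y0 : Y 0 = 0 by rewrite /Y mulrC fpsM0 mul0r.
have Y1 : Y 1 = 16%:R.
  by rewrite /Y -[16%:R in LHS](rmorph_nat (@fpsC K)) fpsCME mulr1.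
apply/eqP; rewrite -subr_eq0; apply/eqP.
apply: (@dil_contract K (X + Y) 16%:R).
- by rewrite fpsDE X0 Y0 addr0.
- rewrite fpsDE X1 Y1 -natrD (natrM _ 8 4) (natrM _ 4 2).
  by rewrite !mulf_neq0 ?four_neq0.
- by rewrite fpsBE X0 Y0 subrr.
- by rewrite fpsBE X1 Y1 subrr.
by rewrite rmorphB [RHS]mulrBr -XX -YY; ring.
Qed.

End Lambda.

(** * The Hasse polynomial *)

Section Hasse.
Variables (K : fieldType) (l h : nat).
Hypothesis charK : l \in [pchar K].
Hypothesis lE : l = h.*2.+1.
Hypothesis h_gt0 : (0 < h)%N.

Definition hasse_coef i : K := ('C(h, i) ^ 2)%:R.

(** The reduction mod l = 2h + 1 of the truncated series of
    2F1(1/2, 1/2; 1; X), since binomial(-1/2, i) = binomial(h, i) mod l. *)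
Definition hasse : {poly K} := \poly_(i < h.+1) hasse_coef i.
Local Notation c := hasse_coef.
Local Notation H := hasse.

Lemma natr_eq0_char m : (m%:R == 0 :> K) = (l %| m)%N.
Proof. by rewrite -(dvdn_pcharf charK). Qed.

Lemma natr_lt_neq0 m : (0 < m < l)%N -> m%:R != 0 :> K.
Proof. by rewrite natr_eq0_char => /andP[m0 ml]; rewrite gtnNdvd. Qed.

Lemma two_h : h%:R *+ 2 = -1 :> K.
Proof.
apply/eqP; rewrite -subr_eq0 opprK -mulr_natr -natrM natr1 natr_eq0_char.
by rewrite lE muln2.
Qed.

Lemma hasse_coefS i : (i.+1%:R ^+ 2) *+ 4 * c i.+1 = (i.*2.+1)%:R ^+ 2 * c i.
Proof.
have [ih|hi] := leqP i h; last first.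
  by rewrite /c !bin_small ?(ltnW hi) // ?mulr0 // ltnW.
have E : (i.+1%:R * 'C(h, i.+1)%:R) *+ 2 = - ((i.*2.+1)%:R * 'C(h, i)%:R) :> K.
  rewrite -natrM mul_bin_left natrM natrB // -mulrnAl mulrnBl two_h -mulNr.
  by congr (_ * _); rewrite -muln2 -natr1 natrM; ring.
by rewrite /c !natrX -[RHS]exprMn -[RHS]sqrrN -E; ring.
Qed.

Lemma coef_hasse i : H`_i = c i.
Proof.
rewrite coef_poly ltnS; case: leqP => // hi.
by rewrite /c bin_small.
Qed.

Lemma hasse_at0 : H`_0 = 1.
Proof. by rewrite coef_hasse /c bin0. Qed.

Lemma size_hasse : size H = h.+1.
Proof. by rewrite size_poly_eq // /c binn oner_neq0. Qed.

Lemma hasse_neq0 : H != 0.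
Proof. by rewrite -size_poly_eq0 size_hasse. Qed.

(** ** The Landen transformation mod l *)

Definition thetaX (y : {poly K}) := 'X * y^`().

Lemma coef_thetaX y m : (thetaX y)`_m = m%:R * y`_m.
Proof.
case: m => [|m]; first by rewrite coefXM mul0r.
by rewrite coefXM /= coef_deriv mulr_natl.
Qed.

(** X times the operator that annihilates the complete elliptic integral K(X) as a
    function of the modulus X.  Up to the factor pi/2, H(X^2) is the reduction mod l
    of a truncation of its power series. *)
Definition legendre_op y :=
  thetaX (thetaX y) - 'X^2 * (thetaX (thetaX y) + thetaX y *+ 2 + y).

Lemma coef_legendre_op y m : (legendre_op y)`_m =
  m%:R ^+ 2 * y`_m - (if m is m'.+2 then m'.+1%:R ^+ 2 * y`_m' else 0).
Proof.
rewrite coefB !coef_thetaX coefXnM mulrA; congr (_ - _).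
case: m => [|[|m]] //=; rewrite !subSS subn0 !coefD !coef_thetaX -natr1; ring.
Qed.

Lemma legendre_op_is_zmod_morphism : zmod_morphism legendre_op.
Proof.
by move=> y w; rewrite /legendre_op /thetaX !(derivB, mulrBr, derivM, derivX); ring.
Qed.

HB.instance Definition _ := GRing.isZmodMorphism.Build {poly K} {poly K}
  legendre_op legendre_op_is_zmod_morphism.

(** The recursion for the coefficients cannot break down before X^l. *)
Lemma legendre_op_inj y : legendre_op y = 0 -> (size y <= l)%N -> y`_0 = 0 -> y = 0.
Proof.
move=> Ly sy y0; apply/polyP => m; rewrite coef0; elim/ltn_ind: m => m IH.
have [lm|ml] := leqP l m; first by rewrite nth_default // (leq_trans sy).
case: m IH ml => // m IH ml; have := coef_legendre_op y m.+1; rewrite Ly coef0.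
rewrite (_ : (if m.+1 is m'.+2 then m'.+1%:R ^+ 2 * y`_m' else 0) = 0); last first.
  by case: m IH ml => // m IH _; rewrite IH ?mulr0.
have m0 : m.+1%:R != 0 :> K by apply: natr_lt_neq0.
by move/esym/eqP; rewrite subr0 mulf_eq0 expf_eq0 (negPf m0) => /eqP.
Qed.

(** What the Landen transformation makes of H(lambda): with lambda = 4k / (1+k)^2 it is
    (1+k)^(2h) H(lambda), as a polynomial in k. *)
Definition landen_poly : {poly K} :=
  \sum_(i < h.+1) (c i *+ 4 ^ i) *: ('X^i * (1 + 'X) ^+ (h - i).*2).

Lemma legendre_op_hasse : legendre_op (H \Po 'X^2) = 0.
Proof.
apply/polyP => m; rewrite coef_legendre_op coef0.
have Hodd j : odd j -> (H \Po 'X^2)`_j = 0.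
  by move=> oj; rewrite coef_comp_poly_Xn // dvdn2 oj.
have [om|em] := boolP (odd m).
  rewrite Hodd // mulr0; case: m om => [|[|m]] om; rewrite ?subrr //.
  by rewrite Hodd ?mulr0 ?subrr //; move: om; rewrite /= negbK.
have := even_halfK em; case: {em}m./2 => [|i] <-; first by rewrite /= expr0n mul0r subrr.
have HE j : (H \Po 'X^2)`_j.*2 = c j.
  by rewrite coef_comp_poly_Xn // dvdn2 odd_double /= divn2 doubleK coef_hasse.
rewrite doubleS HE -doubleS HE -hasse_coefS -muln2 natrM; ring.
Qed.

Lemma thetaXM u v : thetaX (u * v) = thetaX u * v + u * thetaX v.
Proof. by rewrite /thetaX derivM; ring. Qed.

Lemma thetaXD u v : thetaX (u + v) = thetaX u + thetaX v.
Proof. by rewrite /thetaX derivD mulrDr. Qed.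

Lemma thetaX_Xn i : thetaX 'X^i = i%:R * 'X^i.
Proof.
rewrite /thetaX derivXn mulrnAr -mulr_natl; case: i => [|i]; first by rewrite !mul0r.
by rewrite -exprS.
Qed.

Lemma thetaX_add1X e : thetaX ((1 + 'X) ^+ e) = e%:R * 'X * (1 + 'X) ^+ e.-1.
Proof.
rewrite /thetaX deriv_exp derivD derivX (derivC 1) add0r mul1r.
by rewrite mulrnAr -mulr_natl mulrA.
Qed.

(** By [hasse_coefS], the second term at i cancels the first one at i + 1 once both
    are multiplied by the coefficients of [landen_poly], whose sum over i
    therefore telescopes. *)
Lemma legendre_op_landen_term i : (i <= h)%N ->
  legendre_op ('X^i * (1 + 'X) ^+ (h - i).*2) =
  (1 - 'X) * (('X^i * (1 + 'X) ^+ (h - i).*2.+1) * i%:R ^+ 2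
              - ('X^(i.+1) * (1 + 'X) ^+ (h - i).*2.-1) * (i.*2.+1)%:R ^+ 2).
Proof.
move=> ih; have oE : (i.*2.+1)%:R = 1 + i%:R *+ 2 :> {poly K}.
  by rewrite -natr1 -muln2 natrM; ring.
have eE : (h - i).*2%:R = - (1 + i%:R *+ 2) :> {poly K}.
  have : (h - i).*2%:R = - (i.*2.+1)%:R :> K.
    by rewrite -muln2 natrM natrB // -[i.*2.+1%:R]natr1 -muln2 natrM opprD -two_h; ring.
  by move=> /(congr1 polyC); rewrite rmorphN !rmorph_nat oE.
have op2 e' : (h - i).*2 = e'.+2 ->
    legendre_op ('X^i * (1 + 'X) ^+ e'.+2) =
    (1 - 'X) * (('X^i * (1 + 'X) ^+ e'.+3) * i%:R ^+ 2
      - ('X^(i.+1) * (1 + 'X) ^+ e'.+1) * (1 + i%:R *+ 2) ^+ 2).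
  move=> he; rewrite he in eE.
  have eE1 : e'.+1%:R = - (1 + i%:R *+ 2) - 1 :> {poly K}.
    by rewrite -eE -[in RHS]natr1 addrK.
  have tX : thetaX 'X = 'X :> {poly K} by rewrite /thetaX derivX mulr1.
  have tn n : thetaX (n%:R) = 0 :> {poly K}.
    by rewrite /thetaX -(rmorph_nat polyC) derivC mulr0.
  rewrite /legendre_op.
  rewrite !(thetaXD, thetaXM, thetaX_Xn, thetaX_add1X, tX, tn) /= eE eE1.
  rewrite [in LHS]exprSr !exprS; ring.
move: i ih eE oE op2 => i; rewrite leq_eqVlt => /predU1P[->|ih] eE oE op2; last first.
  rewrite oE; have -> : (h - i).*2 = (h - i).-1.*2.+2 by rewrite -doubleS prednK ?subn_gt0.
  by rewrite op2 // -doubleS prednK ?subn_gt0.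
rewrite subnn /= expr0 mulr1 expr1 {op2}.
have hE : 1 + h%:R *+ 2 = 0 :> {poly K}.
  by move/eqP: eE; rewrite subnn eq_sym oppr_eq0 => /eqP.
have tn n : thetaX (n%:R) = 0 :> {poly K}.
  by rewrite /thetaX -(rmorph_nat polyC) derivC mulr0.
rewrite oE hE expr0n mulr0 subr0 /legendre_op !(thetaXM, thetaX_Xn, tn) mul0r add0r.
have -> : h%:R * (h%:R * 'X^h) + (h%:R * 'X^h) *+ 2 + 'X^h =
    h%:R * (h%:R * 'X^h) + (1 + h%:R *+ 2) * 'X^h :> {poly K} by ring.
by rewrite hE mul0r addr0; ring.
Qed.

Lemma legendre_op_landen : legendre_op landen_poly = 0.
Proof.
pose w i : {poly K} :=
  (c i *+ 4 ^ i)%:P * ('X^i * (1 + 'X) ^+ (h.*2.+1 - i.*2)) * i%:R ^+ 2.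
have opZ a y : legendre_op (a *: y) = a *: legendre_op y.
  apply/polyP => m; rewrite coefZ !coef_legendre_op.
  by case: m => [|[|m]]; rewrite !coefZ; ring.
rewrite raddf_sum /=.
transitivity (\sum_(i < h.+1) (1 - 'X) * - (w i.+1 - w i)).
  apply: eq_bigr => i _; have ih : (i <= h)%N by rewrite -ltnS.
  rewrite opZ legendre_op_landen_term // -mul_polyC.
  have : (c i *+ 4 ^ i) * (i.*2.+1)%:R ^+ 2 = (c i.+1 *+ 4 ^ i.+1) * i.+1%:R ^+ 2.
    rewrite mulrnAl mulrC -hasse_coefS expnS -(mulr_natr _ (4 * _)) natrM -mulr_natr.
    by ring.
  move=> /(congr1 polyC); rewrite !polyCM -!rmorphXn /= !rmorphXn /= !polyC_natr => E.
  have e1 : (h.*2.+1 - i.*2 = (h - i).*2.+1)%N by lia.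
  have e2 : (h.*2.+1 - i.+1.*2 = (h - i).*2.-1)%N by lia.
  rewrite /w e1 e2.
  have -> : (c i.+1 *+ 4 ^ i.+1)%:P *
      ('X^(i.+1) * (1 + 'X) ^+ (h - i).*2.-1) * i.+1%:R ^+ 2 =
      (c i.+1 *+ 4 ^ i.+1)%:P * i.+1%:R ^+ 2 *
      ('X^(i.+1) * (1 + 'X) ^+ (h - i).*2.-1) by ring.
  by rewrite -E; ring.
rewrite -mulr_sumr sumrN -(big_mkord xpredT (fun i => w i.+1 - w i)).
rewrite telescope_sumr // /w /c bin_small // exp0n // mul0rn polyC0 !mul0r.
by rewrite expr0n mulr0 subr0 oppr0 mulr0.
Qed.

Lemma landen_polyE : landen_poly = H \Po 'X^2.
Proof.
apply/eqP; rewrite -subr_eq0; apply/eqP/legendre_op_inj.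
- by rewrite raddfB /= legendre_op_hasse legendre_op_landen subrr.
- rewrite (leq_trans (size_polyD _ _)) // size_polyN geq_max; apply/andP; split.
    apply: (leq_trans (size_sum _ _ _)); apply/bigmax_leqP => i _.
    rewrite (leq_trans (size_scale_leq _ _)) // (leq_trans (size_polyMleq _ _)) //.
    rewrite size_polyXn addSn /= (leq_trans (leq_add (leqnn i) (size_poly_exp_leq _ _))) //.
    rewrite addrC size_XaddC mul1n lE; have := ltn_ord i; lia.
  rewrite (leq_trans (size_comp_poly_leq _ _)) // size_hasse size_polyXn lE.
  by rewrite muln2.
rewrite coefB coef_comp_poly_Xn // dvdn0 div0n hasse_at0 -horner_coef0 horner_sum.
rewrite big_ord_recl big1 ?addr0 => [|i _].
  by rewrite /c bin0 !hornerE expr1n subrr.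
by rewrite hornerZ hornerM hornerXn expr0n mul0r mulr0.
Qed.

(** Dwork's form of Jacobi's theta_3^2 = 2F1(1/2, 1/2; 1; lambda): the left-hand
    side is invariant under q -> q^2. *)
Lemma hasse_lambda : peval (lambda K) H * zser K ^+ h.*2 = 1.
Proof.
have two0 : 2%:R != 0 :> K by apply: natr_lt_neq0; lia.
pose k := kser K; pose z := zser K.
set w := LHS.
have wE : w = dil w.
  rewrite /w rmorphM rmorphXn /= peval_dil (dil_lambda two0) -/k.
  rewrite {1}(zser_landen two0) -/k -/z exprMn mulrCA [RHS]mulrC; congr (_ * _).
  have -> : peval (k ^+ 2) H = peval k (H \Po 'X^2).
    by rewrite peval.unlock map_comp_poly map_polyXn horner_comp hornerXn.
  rewrite -landen_polyE /hasse /landen_poly poly_def !rmorph_sum mulr_suml /=.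
  apply: eq_bigr => i _; have ih : (i <= h)%N by rewrite -ltnS.
  rewrite -!mul_polyC 3!rmorphM !rmorphXn rmorphD rmorph1 /= !pevalX !pevalC.
  have -> : h.*2 = (i + i + (h - i).*2)%N by lia.
  rewrite !exprD mulrA.
  have -> : fpsC (c i) * lambda K ^+ i * ((1 + k) ^+ i * (1 + k) ^+ i) =
      fpsC (c i) * (lambda K * (1 + k) ^+ 2) ^+ i.
    by rewrite exprMn -exprM mulnC exprM expr2 -exprMn; ring.
  rewrite (lambda_landen two0) exprMn -[c i *+ _]mulr_natr rmorphM.
  by rewrite (rmorph_nat _ (4 ^ i)) natrX !mulrA.
rewrite (dil_fixed wE) /w fpsM0 peval_coef0 ?lambda0 // hasse_at0 mul1r fpsX0.
by rewrite zser0 expr1n rmorph1.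
Qed.

(** The equation of 2F1(1/2, 1/2; 1; X); coefficientwise it is [hasse_coefS]. *)
Lemma hasse_ode :
  thetaX (thetaX H) *+ 4 = 'X * (thetaX (thetaX H) *+ 4 + thetaX H *+ 4 + H).
Proof.
apply/polyP => m; rewrite [RHS]coefXM [LHS]coefMn !coef_thetaX.
case: m => [|m] /=; first by rewrite !mul0r mul0rn.
rewrite [LHS](_ : _ = m.+1%:R ^+ 2 *+ 4 * c m.+1); last by rewrite coef_hasse; ring.
rewrite 2!coefD !coefMn !coef_thetaX !coef_hasse.
have E2 : m.*2.+1%:R = m%:R *+ 2 + 1 :> K by rewrite -natr1 -muln2 natrM mulr_natr.
have := hasse_coefS m; rewrite E2; move: (c m) (c m.+1) => y0 y1 E.
by rewrite E; ring.
Qed.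

(** The local exponents mod l of the hypergeometric equation are 0 and 1 at a point
    other than 0 and 1, and 0 and 0 at 1, while H(0) = 1. *)
Lemma hasse_root_simple x : root H x ->
  [/\ x != 0, x != 1 & exists2 G, H = ('X - x%:P) * G & ~~ root G x].
Proof.
move=> Hx; have two0 : 2%:R != 0 :> K by apply: natr_lt_neq0; lia.
have four0 := four_neq0 two0.
have x0 : x != 0.
  apply: contraTneq Hx => ->.
  by rewrite /root horner_coef0 hasse_at0 oner_neq0.
have [m [Q]] := multiplicity_XsubC H x; rewrite hasse_neq0 /= => Qx HE.
set A := 'X - x%:P in HE.
have m_gt0 : (0 < m)%N.
  by case: m HE => // HE; move: Hx; rewrite HE expr0 mulr1 (negPf Qx).
have Q0 : Q != 0 by apply: contraNneq Qx => ->; rewrite root0.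
have m_le : (m <= h)%N.
  have := size_hasse; rewrite HE size_Mmonic ?monic_exp ?monicXsubC //.
  rewrite size_exp_XsubC addnS /= => e.
  by rewrite -ltnS -e -{1}[m]add0n ltn_add2r size_poly_gt0.
have m0 : m%:R != 0 :> K by apply: natr_lt_neq0; lia.
have Ax : A.[x] = 0 by rewrite !hornerE subrr.
have thetaA (P : {poly K}) :
    A * thetaX (A ^+ m * P) = A ^+ m * ('X * (m%:R * P + A * P^`())).
  rewrite /thetaX derivM deriv_exp derivXsubC mul1r -mulr_natl.
  have -> : A ^+ m = A * A ^+ m.-1 by rewrite -exprS prednK.
  by ring.
pose P1 := 'X * (m%:R * Q + A * Q^`()).
pose P2 := 'X * (m%:R * P1 + A * P1^`()).
have E1 : A * thetaX H = A ^+ m * P1 by rewrite HE [Q * _]mulrC thetaA.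
have E2 : A ^+ 2 * thetaX (thetaX H) = A ^+ m * (P2 - 'X * P1).
  have tA : thetaX A = 'X by rewrite /thetaX derivXsubC mulr1.
  have : A * thetaX (A * thetaX H) = A ^+ m * P2 by rewrite E1 thetaA.
  rewrite thetaXM tA mulrDr mulrCA E1 => E.
  by rewrite mulrBr -E; ring.
(* The equation divided by A^m, where P1 and P2 replace the first and second *)
(* derivatives. *)
have ode : (1 - 'X) * (P2 - 'X * P1) *+ 4 = 'X * (A * P1 *+ 4 + A ^+ 2 * Q).
  have Am0 : A ^+ m != 0 by rewrite expf_neq0 // polyXsubC_eq0.
  apply: (mulfI Am0).
  have -> : A ^+ m * ((1 - 'X) * (P2 - 'X * P1) *+ 4) =
     (1 - 'X) * (A ^+ m * (P2 - 'X * P1)) *+ 4 by ring.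
  have -> : A ^+ m * ('X * (A * P1 *+ 4 + A ^+ 2 * Q)) =
     'X * (A * (A ^+ m * P1) *+ 4 + A ^+ 2 * (Q * A ^+ m)) by ring.
  rewrite -E2 -E1 -HE.
  have := hasse_ode; move: (thetaX H) (thetaX (thetaX H)) => t1 t2 E.
  have -> : (1 - 'X) * (A ^+ 2 * t2) *+ 4 = A ^+ 2 * (t2 *+ 4) - 'X * A ^+ 2 * (t2 *+ 4).
    by ring.
  by rewrite {1}E; ring.
have mx (c' : K) : (m%:R : {poly K}).[c'] = m%:R by rewrite -(rmorph_nat polyC) hornerC.
have P1x : P1.[x] = x * (m%:R * Q.[x]).
  by rewrite /P1 hornerM hornerX hornerD !hornerM mx Ax mul0r addr0.
have P2x : P2.[x] = x * (m%:R * P1.[x]).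
  by rewrite /P2 hornerM hornerX hornerD !hornerM mx Ax mul0r addr0.
have Qx' : Q.[x] != 0 by [].
clear E1 E2; clearbody P2; clearbody P1.
have x1 : x != 1.
  apply/eqP => x1; have A1 : 1 - 'X = - A by rewrite /A x1 polyC1 opprB.
  have ode1 : - (P2 - 'X * P1) *+ 4 = 'X * (P1 *+ 4 + A * Q).
    have A0 : A != 0 by rewrite polyXsubC_eq0.
    apply: (mulfI A0); transitivity (- A * (P2 - 'X * P1) *+ 4); first by ring.
    by rewrite -A1 ode; ring.
  have : (- (P2 - 'X * P1) *+ 4).[x] = ('X * (P1 *+ 4 + A * Q)).[x] by rewrite ode1.
  rewrite hornerMn hornerN hornerD hornerN !(hornerM 'X) hornerX hornerD hornerMn.
  rewrite (hornerM A) Ax mul0r addr0 P2x P1x x1 !mul1r => E.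
  have : m%:R ^+ 2 * 4%:R * Q.[1] = 0.
    rewrite (_ : _ * Q.[1] = m%:R * Q.[1] *+ 4
      - (- (m%:R * (m%:R * Q.[1]) - m%:R * Q.[1]) *+ 4)); last by ring.
    by rewrite E subrr.
  by move/eqP; rewrite !mulf_eq0 (negPf m0) (negPf four0) -x1 (negPf Qx').
have m1 : m = 1%N.
  have : ((1 - 'X) * (P2 - 'X * P1) *+ 4).[x] =
      ('X * (A * P1 *+ 4 + A ^+ 2 * Q)).[x] by rewrite ode.
  rewrite hornerMn (hornerM (1 - 'X)) !(hornerD, hornerN) !(hornerM 'X) hornerX.
  rewrite hornerD hornerMn (hornerM A) (hornerM (A ^+ 2)) horner_exp Ax hornerC P2x P1x => E.
  have {}E : 4%:R * (1 - x) * x ^+ 2 * m%:R * (m%:R - 1) * Q.[x] = 0.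
    rewrite (_ : _ * Q.[x] = (1 - x) *
      (x * (m%:R * (x * (m%:R * Q.[x]))) - x * (x * (m%:R * Q.[x]))) *+ 4); last by ring.
    by rewrite E; ring.
  move/eqP: E; rewrite !mulf_eq0 (negPf m0) (negPf four0) (negPf x0) (negPf Qx').
  rewrite subr_eq0 eq_sym (negPf x1) /= orbF => m1.
  have : (m.-1)%:R == 0 :> K by rewrite -subn1 natrB // subr_eq0.
  have [|m2] := posnP m.-1; first by lia.
  by rewrite (negPf (natr_lt_neq0 _)) //; lia.
split=> //; exists Q => //.
by rewrite HE m1 mulrC.
Qed.

End Hasse.

(** * Multiplicities of roots *)

Section Multiplicity.
Variable K : fieldType.
Implicit Types P Q : {poly K}.

Definition has_mult (x : K) m P := exists2 Q, P = ('X - x%:P) ^+ m * Q & ~~ root Q x.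

Lemma has_mult_exists x P : P != 0 -> exists m, has_mult x m P.
Proof.
move=> P0; have [m [Q]] := multiplicity_XsubC P x; rewrite P0 /= => Qx PE.
by exists m, Q; rewrite // mulrC.
Qed.

Lemma has_mult_neq0 x m P : has_mult x m P -> P != 0.
Proof.
case=> Q -> Qx; rewrite mulf_neq0 ?expf_neq0 ?polyXsubC_eq0 //.
by apply: contraNneq Qx => ->; rewrite root0.
Qed.

Lemma has_mult_dvd x m k P : has_mult x m P -> (('X - x%:P) ^+ k %| P) = (k <= m)%N.
Proof.
case=> Q -> Qx; apply/idP/idP => [|km].
  apply: contraTT; rewrite -ltnNge => mk.
  rewrite -(subnKC (ltnW mk)) exprD dvdp_mul2l ?expf_neq0 ?polyXsubC_eq0 //.
  apply: contra Qx => Qd; rewrite -dvdp_XsubCl (dvdp_trans _ Qd) //.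
  by rewrite -{1}['X - _]expr1 dvdp_exp2l // subn_gt0.
by rewrite dvdp_mulr // dvdp_exp2l.
Qed.

Lemma has_mult_unique x m n P : has_mult x m P -> has_mult x n P -> m = n.
Proof.
move=> Pm Pn; apply/eqP; rewrite eqn_leq -(has_mult_dvd _ Pn) -(has_mult_dvd _ Pm).
by rewrite (has_mult_dvd _ Pm) (has_mult_dvd _ Pn) !leqnn.
Qed.

Lemma has_mult0 x P : ~~ root P x -> has_mult x 0 P.
Proof. by exists P; rewrite // mul1r. Qed.

Lemma has_multM x m n P Q : has_mult x m P -> has_mult x n Q -> has_mult x (m + n) (P * Q).
Proof.
move=> [P1 -> P1x] [Q1 -> Q1x]; exists (P1 * Q1); first by rewrite exprD; ring.
by rewrite rootM negb_or P1x.
Qed.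

Lemma has_multX x m n P : has_mult x m P -> has_mult x (m * n) (P ^+ n).
Proof.
move=> [P1 -> P1x]; exists (P1 ^+ n); first by rewrite exprMn -exprM.
by rewrite rootE horner_exp expf_neq0.
Qed.

Lemma has_multD_dvd x m P Q :
  has_mult x m P -> ('X - x%:P) ^+ m.+1 %| Q -> P + Q != 0.
Proof.
move=> Pm mQ; apply/eqP => /(canRL (addrK _)); rewrite sub0r => PE.
by have := has_mult_dvd m.+1 Pm; rewrite PE dvdpNr mQ ltnn.
Qed.

Lemma prod_XsubC_exp_dvd (s : seq (K * nat)) P : uniq (map fst s) ->
  (forall v, v \in s -> ('X - v.1%:P) ^+ v.2 %| P) ->
  \prod_(v <- s) ('X - v.1%:P) ^+ v.2 %| P.
Proof.
elim: s => [|v s IH] /=; first by rewrite big_nil dvd1p.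
case/andP=> vs us sP; rewrite big_cons Gauss_dvdp; last first.
  rewrite coprimep_expl // coprimep_sym coprimep_XsubC rootE horner_prod.
  rewrite prodf_seq_neq0; apply/allP => w ws /=.
  rewrite horner_exp expf_neq0 // hornerXsubC subr_eq0.
  by apply: contraNneq vs => ->; apply: map_f.
by rewrite sP ?mem_head // IH // => w ws; rewrite sP // inE ws orbT.
Qed.

End Multiplicity.

(** * A Kummer extension of the field of rational functions *)

Section Kummer.
Variable K : closedFieldType.

Lemma factor_Xn_sub_exp (y : fps K) n : (0 < n)%N -> y \is a GRing.unit ->
  exists2 r : seq K, size r = n /\ 0 \notin r &
    'X^n - (y ^+ n)%:P = \prod_(x <- r) ('X - (fpsC x * y)%:P).
Proof.
move=> n0 yu; have [r rE] := closed_field_poly_normal ('X^n - 1 : {poly K}).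
have monic1 : ('X^n - 1 : {poly K}) \is monic by apply: monicXnsubC.
rewrite (monicP monic1) scale1r in rE.
have sr : size r = n.
  have := congr1 (fun p : {poly K} => size p) rE.
  by rewrite size_prod_XsubC size_XnsubC // => -[].
exists r; first split=> //.
  apply/negP => r0; have := congr1 (fun p : {poly K} => p.[0]) rE.
  have /eqP -> : root (\prod_(z <- r) ('X - z%:P)) 0 by rewrite root_prod_XsubC.
  rewrite hornerD hornerN hornerXn hornerC expr0n gtn_eqF // sub0r => /eqP.
  by rewrite oppr_eq0 oner_eq0.
pose w : {poly fps K} := (y^-1)%:P * 'X.
have yw : y%:P * w = 'X by rewrite mulrA -polyCM divrr // mul1r.
have E : w ^+ n - 1 = \prod_(x <- r) (w - (fpsC x)%:P).
  have : map_poly (@fpsC K) ('X^n - 1) \Po w =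
      map_poly (@fpsC K) (\prod_(z <- r) ('X - z%:P)) \Po w by rewrite rE.
  rewrite rmorphB rmorph1 /= map_polyXn comp_polyB comp_Xn_poly (comp_polyC 1) => ->.
  rewrite rmorph_prod /= (rmorph_prod (comp_poly w)); apply: eq_bigr => x _.
  by rewrite map_polyXsubC /= comp_polyB comp_polyX comp_polyC.
rewrite -yw (rmorphXn polyC) exprMn /=.
have -> : y%:P ^+ n * w ^+ n - y%:P ^+ n = y%:P ^+ n * (w ^+ n - 1) by ring.
have -> : y%:P ^+ n = \prod_(x <- r) y%:P.
  by rewrite big_const_seq count_predT sr iter_mulr_1.
rewrite E -big_split.
by apply: eq_bigr => x _; rewrite polyCM /=; ring.
Qed.

(** If y^h = A(f) for a series f transcendental over K, and the polynomial A has
    a root of multiplicity prime to h, then 1, y, ..., y^(h-1) are linearly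
    independent over K(f).  Indeed a factor of Y^h - A over K(f) is a product of
    some of the factors Y - zeta y, with zeta^h = 1, hence some y^d with 0 < d < h
    would be in K(f). *)
Lemma kummer_independent (f y : fps K) h A x m (B : nat -> {poly K}) :
  f 0 = 0 -> f 1 != 0 -> (0 < h)%N -> y \is a GRing.unit ->
  y ^+ h = peval f A -> has_mult x m A -> coprime h m ->
  \sum_(j < h) y ^+ j * peval f (B j) = 0 ->
  forall j, (j < h)%N -> B j = 0.
Proof.
move=> f0 f1 h0 yu yA Am hm relB.
have f_inj := peval_inj f0 f1.
pose P : {poly {poly K}} := \poly_(j < h) B j.
suff P0 : P = 0 by move=> j jh; have := coef_poly h B j; rewrite -/P P0 jh coef0.
pose F : {poly {poly K}} := 'X^h - A%:P.
pose ev (Q : {poly {poly K}}) := (map_poly (peval f) Q).[y].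
have sF : size F = h.+1 by rewrite size_XnsubC.
have evP : ev P = 0.
  rewrite /ev /P poly_def rmorph_sum horner_sum -[RHS]relB; apply: eq_bigr => j _.
  by rewrite /= map_polyZ map_polyXn hornerZ hornerXn mulrC.
have evF : ev F = 0.
  by rewrite /ev rmorphB /= map_polyXn map_polyC hornerD hornerN hornerXn hornerC yA subrr.
apply/eqP/negPn/negP => P_neq0.
have sP : (1 < size P)%N.
  rewrite ltnNge; apply/negP => /size1_polyC PE; case/eqP: P_neq0.
  move: evP; rewrite /ev PE map_polyC hornerC -(rmorph0 (peval f)) => /f_inj ->.
  by rewrite polyC0.
have sF1 : (1 < size F)%N by rewrite sF ltnS.
have : resultant F P = 0.
  have [uv _ /(congr1 ev)] := resultant_in_ideal sF1 sP.
  rewrite /ev map_polyC hornerC rmorphD !rmorphM hornerD !hornerM /=.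
  by rewrite -/(ev F) -/(ev P) evF evP !mulr0 addr0 -(rmorph0 (peval f)) => /f_inj.
move/eqP; rewrite resultant_eq0; set g := gcdp F P => sg.
have g_le : (size g <= h)%N.
  by rewrite (leq_trans (leq_gcdpr _ P_neq0)) // size_poly.
have /Pdiv.WeakIdomain.dvdpP[[c Q] /= c0 cF] : g %| F := dvdp_gcdl F P.
have [r [sr r0] rE] := factor_Xn_sub_exp h0 yu.
pose G := map_poly (peval f) g.
have sG : size G = size g by apply: size_map_inj_poly; [exact: f_inj | exact: rmorph0].
have : G %| \prod_(z <- r) ('X - (fpsC z * y)%:P).
  apply/Pdiv.WeakIdomain.dvdpP; exists (peval f c, map_poly (peval f) Q) => /=.
    by rewrite -(rmorph0 (peval f)) (inj_eq f_inj).
  rewrite -rE yA -rmorphM -cF /= map_polyZ; congr (_ *: _).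
  by rewrite rmorphB /= map_polyXn map_polyC.
move=> /dvdp_prod_XsubC[mk /eqpP[[c1 c2] /= /andP[c10 c20] GE]].
set s := mask mk r in GE.
have sE : (size s).+1 = size g.
  by rewrite -sG -(size_scale _ c10) GE size_scale // size_prod_XsubC.
pose gamma := \prod_(z <- s) (- z).
have gamma0 : gamma != 0.
  rewrite prodf_seq_neq0; apply/allP => z /mem_mask zr /=.
  by rewrite oppr_eq0; apply: contraNneq r0 => <-.
have lead0 : lead_coef g != 0.
  by rewrite lead_coef_eq0 -size_poly_eq0 -sE.
have lead_c2 : c1 * peval f (lead_coef g) = c2.
  have := congr1 lead_coef GE; rewrite !lead_coefZ.
  rewrite (monicP (monic_prod_XsubC _ _ _)) mulr1 lead_coef_map_inj //; exact: rmorph0.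
have yd : peval f g`_0 = peval f (lead_coef g * gamma%:P) * y ^+ size s.
  apply: (mulfI c10); rewrite rmorphM /= pevalC mulrA mulrA lead_c2 -mulrA.
  have := congr1 (fun p : {poly fps K} => p.[0]) GE.
  rewrite !hornerZ [X in c1 * X]horner_coef0 coef_map /= => ->; congr (_ * _).
  rewrite horner_prod /gamma rmorph_prod /=.
  have -> : y ^+ size s = \prod_(z <- s) y by rewrite big_const_seq count_predT iter_mulr_1.
  rewrite -big_split; apply: eq_bigr => z _ /=.
  by rewrite hornerXsubC sub0r rmorphN /= mulNr.
have polyE : g`_0 ^+ h = (lead_coef g * gamma%:P) ^+ h * A ^+ size s.
  apply: f_inj; rewrite rmorphM !rmorphXn /= yd exprMn -yA -!exprM mulnC; ring.
have [a am] := has_mult_exists x lead0.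
have gam : has_mult x 0 gamma%:P by apply: has_mult0; rewrite rootC.
have rhs := has_multM (has_multX h (has_multM am gam)) (has_multX (size s) Am).
rewrite -polyE in rhs.
have g00 : g`_0 != 0.
  by apply: contraTneq (has_mult_neq0 rhs) => ->; rewrite expr0n gtn_eqF // eqxx.
have [b bm] := has_mult_exists x g00.
have E := has_mult_unique (has_multX h bm) rhs.
have : (h %| m * size s)%N.
  by rewrite -(dvdn_addr _ (dvdn_mull (a + 0) (dvdnn h))) -E dvdn_mull.
rewrite Gauss_dvdr // => hs; have s_gt0 : (0 < size s)%N by rewrite -ltnS sE.
by have := dvdn_leq s_gt0 hs; rewrite leqNgt sE g_le.
Qed.

End Kummer.

(** * The Euler derivation on polynomials in lambda *)

Section HasseOp.
Variables (K : fieldType) (l h : nat).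
Hypothesis charK : l \in [pchar K].
Hypothesis lE : l = h.*2.+1.
Hypothesis h_gt0 : (0 < h)%N.
Local Notation H := (hasse K h).
Local Notation z := (zser K).
Local Notation lam := (lambda K).
Local Notation C := (cphi_series K).
Local Notation q := (qvar K).

Let two0 : 2%:R != 0 :> K.
Proof. by apply: (natr_lt_neq0 charK); lia. Qed.

Let Hz : peval lam H * z ^+ h.*2 = 1.
Proof. exact: (hasse_lambda charK lE). Qed.

Lemma fps_char f : f *+ l = 0 :> fps K.
Proof. by apply/fpsP => n; rewrite fpsMn -mulr_natr (pcharf0 charK) mulr0. Qed.

Lemma eulerD_expl f : eulerD (f ^+ l) = 0 :> fps K.
Proof. by rewrite eulerDX fps_char. Qed.

Lemma iter_eulerD_const (kap f : fps K) i : eulerD kap = 0 ->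
  iter i (@eulerD K) (kap * f) = kap * iter i (@eulerD K) f.
Proof. by move=> k0; elim: i => //= i ->; rewrite eulerDM k0 mul0r add0r. Qed.

Lemma iter_eulerDE (f : fps K) i n : iter i (@eulerD K) f n = n%:R ^+ i * f n.
Proof. by elim: i => [|i IH] /=; rewrite ?mul1r // IH exprS mulrA. Qed.

Lemma zser_hasse : z = peval lam H * z ^+ l.
Proof. by rewrite lE exprSr mulrA Hz mul1r. Qed.

(** The action of D on polynomials in lambda, up to a factor z^(2l): since
    z = H(lambda) z^l, the factor z^2 in the derivative of lambda becomes
    H(lambda)^2 z^(2l), and D vanishes on l-th powers. *)
Definition hasse_op (P : {poly K}) : {poly K} := 'X * (1 - 'X) * H ^+ 2 * P^`().

Lemma eulerD_hasse_op P :
  eulerD (peval lam P) = z ^+ l.*2 * peval lam (hasse_op P).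
Proof.
rewrite eulerD_peval (eulerD_lambda two0) 3!rmorphM rmorphB rmorph1 rmorphXn /= pevalX.
rewrite -addnn exprD [in LHS]zser_hasse; ring.
Qed.

Lemma iter_eulerD_hasse_op (kap : fps K) P i : eulerD kap = 0 ->
  iter i (@eulerD K) (kap * peval lam P) =
  kap * z ^+ (l.*2 * i) * peval lam (iter i hasse_op P).
Proof.
move=> k0; rewrite iter_eulerD_const // -mulrA; congr (_ * _).
elim: i => [|i IH]; first by rewrite muln0 mul1r.
have zc : eulerD (z ^+ (l.*2 * i)) = 0.
  by rewrite -muln2 -mulnA mulnC exprM eulerD_expl.
rewrite iterS IH eulerDM zc mul0r add0r eulerD_hasse_op mulrA -exprD.
by rewrite -mulnSr -iterS.
Qed.

Lemma fermat n : n%:R != 0 :> K -> n%:R ^+ h.*2 = 1 :> K.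
Proof.
move=> n0; apply: (mulIf n0); rewrite mul1r -exprSr -lE.
by rewrite -(pFrobenius_autE charK) pFrobenius_aut_nat.
Qed.

(** ** Vanishing of the coefficients in a residue class *)

Lemma residue_zero (f : fps K) :
  (forall n, (l %| n)%N -> f n = 0) -> iter h.*2 (@eulerD K) f = f.
Proof.
move=> f0; apply/fpsP => n; rewrite iter_eulerDE.
have [ln|nl] := boolP (l %| n)%N; first by rewrite f0 // mulr0.
by rewrite fermat ?mul1r // (natr_eq0_char charK).
Qed.

(** The coefficient of q^n on the left is n (n^(l-1) - r^(l-1)) / (n - r) times that
    of f. *)
Lemma residue_nonzero (f : fps K) r : ~~ (l %| r)%N ->
  (forall n, n = r %[mod l] -> f n = 0) ->
  \sum_(i < h.*2) fpsC (r%:R ^+ i) * iter (h.*2 - i) (@eulerD K) f = 0.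
Proof.
move=> lr fr; have r0 : r%:R != 0 :> K by rewrite (natr_eq0_char charK).
apply/fpsP => n; rewrite fps_sumE fps0E.
transitivity ((n%:R * \sum_(i < h.*2) n%:R ^+ (h.*2.-1 - i) * r%:R ^+ i) * f n).
  rewrite mulr_sumr mulr_suml; apply: eq_bigr => i _.
  rewrite fpsCME iter_eulerDE.
  have -> : (h.*2 - i = (h.*2.-1 - i).+1)%N by have := ltn_ord i; lia.
  by rewrite exprS; ring.
have [n0|n0] := eqVneq (n%:R : K) 0; first by rewrite n0 !mul0r.
have [nr|nr] := eqVneq (n%:R : K) r%:R.
  rewrite fr ?mulr0 //; apply/eqP.
  wlog rn : n r {fr lr r0 n0} nr / (r <= n)%N.
    by move=> W; have [/W|/ltnW/W] := leqP r n; [exact | rewrite eq_sym; exact].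
  by rewrite eqn_mod_dvd // -(natr_eq0_char charK) natrB // nr subrr.
apply/eqP; rewrite !mulf_eq0 (negPf n0) /=; apply/orP; left.
have : n%:R ^+ h.*2 - r%:R ^+ h.*2 == 0 :> K by rewrite !fermat // subrr.
by rewrite subrXX mulf_eq0 subr_eq0 (negPf nr).
Qed.

Lemma hasse_op_dvd A P m : A ^+ m %| P -> A %| 'X * (1 - 'X) * H ^+ 2 ->
  A ^+ m %| hasse_op P.
Proof.
case: m => [|m]; first by rewrite expr0 !dvd1p.
move=> /dvdpP[Q ->] /dvdpP[T TE]; rewrite /hasse_op TE derivM deriv_exp.
by apply/dvdpP; exists (T * (Q^`() * A + Q * A^`() *+ m.+1)); rewrite exprSr /=; ring.
Qed.

Lemma size_hasse_op P : (size (hasse_op P) <= size P + l)%N.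
Proof.
have [P0|P0] := eqVneq P^`() 0; first by rewrite /hasse_op P0 mulr0 size_poly0.
have sT : (size ('X * (1 - 'X) * H ^+ 2)%R <= l.+2)%N.
  have s1 : size (1 - 'X : {poly K}) = 2 by rewrite -size_polyN opprB size_XsubC.
  have s2 : (size ('X * (1 - 'X) : {poly K})%R <= 3)%N.
    by rewrite (leq_trans (size_polyMleq _ _)) // size_polyX s1.
  have := size_poly_exp_leq H 2; rewrite size_hasse /= => s3.
  rewrite (leq_trans (size_polyMleq _ _)) // -ltnS prednK; last first.
    rewrite addn_gt0; apply/orP; left.
    by rewrite size_poly_gt0 mulf_neq0 ?polyX_eq0 // -size_poly_eq0 s1.
  by rewrite (leq_trans (leq_add s2 s3)) // lE; lia.
have P_neq0 : P != 0 by apply: contraNneq P0 => ->; rewrite derivC.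
have sP := lt_size_deriv P_neq0.
rewrite /hasse_op (leq_trans (size_polyMleq _ _)) //.
have := leq_add sT sP; rewrite addnS !addSn ltnS => le_size.
by rewrite -subn1 leq_subLR (leq_trans le_size) // add1n [(_ + l)%N]addnC.
Qed.

Lemma size_iter_hasse_op P i : (size (iter i hasse_op P) <= size P + i * l)%N.
Proof.
elim: i => [|i IH]; first by rewrite addn0.
by rewrite iterS (leq_trans (size_hasse_op _)) // mulSn [(l + _)%N]addnC addnA leq_add2r.
Qed.

(** When l divides m, the derivative loses the term m ('X - x)^(m-1) and the
    multiplicity jumps. *)
Lemma hasse_op_mult x m P : root H x -> has_mult x m P ->
  if (l %| m)%N then exists Q, hasse_op P = ('X - x%:P) ^+ m.+2 * Q
  else has_mult x m.+1 (hasse_op P).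
Proof.
move=> Hx [Q PE Qx]; have [x0 x1 [T HE Tx]] := hasse_root_simple charK lE h_gt0 Hx.
set A := 'X - x%:P in PE HE *.
pose Q1 := 'X * (1 - 'X) * T ^+ 2 * (m%:R * Q + A * Q^`()).
have opE : hasse_op P = A ^+ m.+1 * Q1.
  rewrite /hasse_op HE PE /Q1 derivM deriv_exp derivXsubC mul1r -mulr_natl (exprSr A m).
  case: (m) => [|m']; first by rewrite /= expr0; ring.
  by rewrite /= (exprSr A m'); ring.
have mE (c : K) : (m%:R : {poly K}).[c] = m%:R by rewrite -(rmorph_nat polyC) hornerC.
case: ifP => [lm|lm].
  have m0 : m%:R = 0 :> {poly K}.
    by apply/eqP; rewrite -(rmorph_nat polyC) polyC_eq0 (natr_eq0_char charK).
  exists ('X * (1 - 'X) * T ^+ 2 * Q^`()).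
  by rewrite opE /Q1 m0 [A ^+ m.+2]exprSr; ring.
have Ax : A.[x] = 0 by rewrite hornerXsubC subrr.
exists Q1 => //; rewrite rootE /Q1 3!hornerM (hornerD (_ * Q)) (hornerM _ Q) mE.
rewrite (hornerM A) Ax mul0r addr0 horner_exp hornerX hornerD hornerN hornerX hornerC.
rewrite !mulf_neq0 //.
- by rewrite subr_eq0 eq_sym.
by rewrite (natr_eq0_char charK) lm.
Qed.

(** ** The generating function as a polynomial in lambda *)

Lemma cphi_lambda : lam * (1 - lam) ^+ 4 * z ^+ 6 * C ^+ 12 = 16%:R * q.
Proof.
rewrite -(partition_lambda two0) cphi_series_theta -[theta 1]/(theta 1).
have phi2 : theta (1 : K) ^+ 2 = z by rewrite zser.unlock.
have b8 : bser K ^+ 8 = (1 - lam) ^+ 4 * z ^+ 8.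
  by rewrite (exprM _ 2 4) -(one_sub_lambda K); ring.
have -> : (partition_series K ^+ 2 * theta 1) ^+ 12 =
  partition_series K ^+ 24 * (theta 1 ^+ 2) ^+ 6 by ring.
by rewrite phi2 b8; ring.
Qed.

Variables (u t : nat).
Hypothesis uE : (12 * u).+1 = (l * t)%N.

Definition cphi_poly : {poly K} := 'X^u * (1 - 'X) ^+ (4 * u) * H ^+ h.
Definition cphi_const : fps K := (C ^+ t * z ^+ (t./2 + h)) ^+ l.
Local Notation G := cphi_poly.
Local Notation kap := cphi_const.

Lemma eulerD_cphi_const : eulerD kap = 0.
Proof. exact: eulerD_expl. Qed.

Lemma cphi_series0 : C 0 = 1.
Proof. by rewrite cphi_seriesE fsumE big_ord1 mul1r fpsM0 fpsM0 /= !mulr1. Qed.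

Lemma cphi_const_neq0 : kap != 0.
Proof.
apply: contraTneq (oner_neq0 K) => k0.
have <- : kap 0 = 1 by rewrite fpsX0 fpsM0 !fpsX0 cphi_series0 zser0 !expr1n mulr1 expr1n.
by rewrite k0 eqxx.
Qed.

(** In characteristic l, q^u C is q^(-1/12) C up to a factor killed by D; and by
    [cphi_lambda], q^(-1/12) C is up to constants a product of fractional powers of
    lambda, 1 - lambda and z, which become integral modulo l-th powers. *)
Lemma cphi_polyE : fpsC (16%:R ^+ u) * (q ^+ u * C) = kap * peval lam G.
Proof.
have t_odd : odd t by have := congr1 odd uE; rewrite oddM lE /= odd_double oddM.
have e6 : (6 * u = h + l * t./2)%N.
  by have := odd_double_half t; rewrite t_odd; nia.
have zE : z ^+ (6 * u) = peval lam H ^+ h * z ^+ (l * (t./2 + h)).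
  by rewrite e6 exprD {1}zser_hasse exprMn -exprM mulnDr exprD; ring.
have CE : C ^+ (12 * u) * C = C ^+ (t * l) by rewrite -exprSr uE mulnC.
rewrite rmorphXn rmorph_nat /= mulrA -exprMn -cphi_lambda 3!exprMn -!exprM zE.
rewrite -[LHS]mulrA CE /cphi_const /cphi_poly 2!rmorphM !rmorphXn rmorphB rmorph1 /=.
by rewrite !pevalX exprMn -!exprM [(l * _)%N]mulnC; ring.
Qed.

Lemma cphi_poly_mult x : root H x -> has_mult x h G.
Proof.
move=> Hx; have [x0 x1 [T HE Tx]] := hasse_root_simple charK lE h_gt0 Hx.
exists ('X^u * (1 - 'X) ^+ (4 * u) * T ^+ h).
  by rewrite /cphi_poly HE exprMn; ring.
rewrite rootE !hornerM hornerXn !horner_exp hornerD hornerN hornerX hornerC.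
by rewrite !mulf_neq0 ?expf_neq0 // subr_eq0 eq_sym.
Qed.

Lemma iter_cphi_poly_mult x j : root H x -> (j <= h.+1)%N ->
  has_mult x (h + j) (iter j hasse_op G).
Proof.
move=> Hx; elim: j => [|j IH] jh; first by rewrite addn0; apply: cphi_poly_mult.
have := hasse_op_mult Hx (IH (ltnW jh)); rewrite addnS gtnNdvd //; lia.
Qed.

End HasseOp.

(** * Congruences modulo primes l > 5 *)

Section LargePrimes.
Variables (K : closedFieldType) (l h u t : nat).
Hypothesis charK : l \in [pchar K].
Hypothesis lE : l = h.*2.+1.
Hypothesis h_ge3 : (2 < h)%N.
Hypothesis uE : (12 * u).+1 = (l * t)%N.
Local Notation H := (hasse K h).
Local Notation z := (zser K).
Local Notation lam := (lambda K).
Local Notation C := (cphi_series K).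
Local Notation q := (qvar K).
Local Notation G := (cphi_poly K h u).
Local Notation kap := (cphi_const K l h t).
Local Notation op := (hasse_op h).

Let h_gt0 : (0 < h)%N. Proof. lia. Qed.

Let two0 : 2%:R != 0 :> K.
Proof. by apply: (natr_lt_neq0 charK); lia. Qed.

Let Hz : peval lam H * z ^+ h.*2 = 1.
Proof. exact: (hasse_lambda charK lE). Qed.

Let const_neq0 : 16%:R ^+ u != 0 :> K.
Proof. by rewrite expf_neq0 // (natrM _ 4 4) mulf_neq0 ?four_neq0. Qed.

Lemma hasse_factor : exists2 r : seq K, uniq r /\ size r = h &
  (H = \prod_(x <- r) ('X - x%:P)) /\ (forall x, x \in r -> root H x).
Proof.
have [r rE] := closed_field_poly_normal H.
have H1 : lead_coef H = 1.
  by rewrite lead_coefE size_hasse coef_hasse /hasse_coef binn.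
rewrite H1 scale1r in rE.
have rH x : x \in r -> root H x by rewrite rE root_prod_XsubC.
exists r; split=> //; last first.
  by have := size_hasse K h; rewrite rE size_prod_XsubC => -[].
have : forall x, x \in r -> ~~ (('X - x%:P) ^+ 2 %| \prod_(y <- r) ('X - y%:P)).
  move=> x xr; rewrite -rE.
  have [_ _ [T HT Tx]] := hasse_root_simple charK lE h_gt0 (rH x xr).
  have Hm : has_mult x 1 H by exists T; rewrite // expr1.
  by rewrite (has_mult_dvd _ Hm).
elim: {rE rH}r => //= x s IH sq; apply/andP; split.
  apply: contra (sq x (mem_head _ _)) => xs.
  by rewrite big_cons expr2 dvdp_mul // dvdp_XsubCl root_prod_XsubC.
apply: IH => y ys; have := sq y; rewrite inE ys orbT big_cons => /(_ isT).
by apply: contra => /(dvdp_mull _).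
Qed.

(** By [residue_nonzero], f = q^u C is killed by a polynomial in D of degree l - 1
    without constant term.  This is a relation between the powers of y = z^(-2l)
    below y^(2h), with polynomials in lambda as coefficients; as y^h = H(lambda)^l,
    it reduces to one between 1, ..., y^(h-1), whose coefficients vanish because h
    is prime to l.  But the coefficient of y^(h-1) involves D^(h+1) f, which has
    multiplicity h + (h + 1) = l at the roots of H, and a term of higher
    multiplicity. *)
Lemma no_congruence_nonzero r : ~~ (l %| r)%N ->
  (forall n, n = r %[mod l] -> (q ^+ u * C) n = 0) -> False.
Proof.
move=> lr fr; have := residue_nonzero charK lE h_gt0 lr fr.
have E i : fpsC (16%:R ^+ u) * iter i (@eulerD K) (q ^+ u * C) =
    kap * z ^+ (l.*2 * i) * peval lam (iter i op G).
  rewrite -iter_eulerD_const ?eulerDC // (cphi_polyE charK lE h_gt0 uE).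
  by rewrite (iter_eulerD_hasse_op charK lE h_gt0) // eulerD_cphi_const.
pose y := (z ^+ l.*2)^-1.
have yu : y \is a GRing.unit by rewrite unitrV unitrX // zser_unit.
have zy i : z ^+ (l.*2 * i) * y ^+ i = 1.
  by rewrite exprM -exprMn divrr ?expr1n // unitrX // zser_unit.
have yh : y ^+ h = peval lam (H ^+ l).
  have zh : z ^+ (l.*2 * h) = (z ^+ h.*2) ^+ l by rewrite -exprM; congr (_ ^+ _); lia.
  apply: (mulfI (_ : z ^+ (l.*2 * h) != 0)); first by rewrite expf_neq0 // zser_neq0.
  by rewrite zy zh rmorphXn -exprMn [z ^+ _ * _]mulrC Hz expr1n.
move=> /(congr1 (fun f => fpsC (16%:R ^+ u) * f * y ^+ h.*2)).
rewrite mulr0 mul0r mulr_sumr mulr_suml => rel.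
have rel2 : \sum_(i < h.*2) fpsC (r%:R ^+ i) * y ^+ i * peval lam (iter (h.*2 - i) op G) = 0.
  have kap0 : kap != 0 by apply: cphi_const_neq0.
  apply: (mulfI kap0); rewrite mulr0 -[RHS]rel mulr_sumr.
  apply: eq_bigr => i _.
  have -> : y ^+ h.*2 = y ^+ (h.*2 - i) * y ^+ i by rewrite -exprD subnK // ltnW.
  rewrite [fpsC (16%:R ^+ u) * _]mulrCA E.
  transitivity (fpsC (r%:R ^+ i) * kap * y ^+ i * peval lam (iter (h.*2 - i) op G) *
    (z ^+ (l.*2 * (h.*2 - i)) * y ^+ (h.*2 - i))); last by ring.
  by rewrite zy; ring.
pose B j : {poly K} := r%:R ^+ j *: iter (h.*2 - j) op G +
  r%:R ^+ (j + h) *: (H ^+ l * iter (h - j) op G).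
have relB : \sum_(j < h) y ^+ j * peval lam (B j) = 0.
  rewrite -[RHS]rel2 -addnn big_split_ord /= -big_split /=; apply: eq_bigr => j _.
  rewrite rmorphD -!mul_polyC !rmorphM /= !pevalC.
  have -> : (h + h - (h + j) = h - j)%N by lia.
  by rewrite (exprD y h j) yh [(j + h)%N]addnC addnn; ring.
have [x Hx] : exists x, root H x.
  by apply/closed_rootP; rewrite size_hasse; lia.
have Am : has_mult x l (H ^+ l).
  have [_ _ [T HE Tx]] := hasse_root_simple charK lE h_gt0 Hx.
  rewrite -[l in has_mult _ l _]mul1n; apply: has_multX.
  by exists T; rewrite // expr1.
have co : coprime h l by rewrite lE -mul2n /coprime -addn1 gcdnMDl gcdn1.
have B0 : B h.-1 = 0.
  apply: (kummer_independent (lambda0 two0) (lambda_unif two0) h_gt0 yu yh Am co relB).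
  by rewrite prednK.
suff /eqP[] : B h.-1 != 0 by [].
have i1 : (h.*2 - h.-1 = h.+1)%N by lia.
have i2 : (h - h.-1 = 1)%N by lia.
have r0 : r%:R != 0 :> K by rewrite (natr_eq0_char charK).
have itm j := @iter_cphi_poly_mult K l h charK lE h_gt0 u t uE x j Hx.
rewrite /B i1 i2; apply: (@has_multD_dvd _ x l).
  have := itm h.+1 (leqnn _).
  rewrite addnS addnn -lE -mul_polyC -[l in has_mult _ l (_ * _)]add0n => m1.
  apply: has_multM m1; apply: has_mult0; by rewrite rootC expf_neq0.
by rewrite -mul_polyC dvdp_mull // (has_mult_dvd _ (has_multM Am (itm 1 _))) //; lia.
Qed.

(** Here D^(l-1) f = f for f = q^u C, that is, hasse_op^(l-1) G = H^(2l) G.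
    The multiplicity of a root of H increases by one at each application of D,
    except at the multiplicities divisible by l.  To come back to H^(2l) G after
    l - 1 steps it has to jump over almost l at the only such step, the (h+2)-nd;
    this leaves room for a cofactor of degree at most 2. *)
Lemma congruence_zero : (forall n, (l %| n)%N -> (q ^+ u * C) n = 0) ->
  exists2 R : {poly K}, (size R <= 3)%N &
    iter h.+2 (@eulerD K) (q ^+ u * C) = q ^+ u * C * z ^+ 4 * peval lam R.
Proof.
move=> f0; have fD := residue_zero charK lE f0.
have E i : fpsC (16%:R ^+ u) * iter i (@eulerD K) (q ^+ u * C) =
    kap * z ^+ (l.*2 * i) * peval lam (iter i op G).
  rewrite -iter_eulerD_const ?eulerDC // (cphi_polyE charK lE h_gt0 uE).
  by rewrite (iter_eulerD_hasse_op charK lE h_gt0) // eulerD_cphi_const.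
have kap0 : kap != 0 by apply: cphi_const_neq0.
have lam_inj := peval_inj (lambda0 two0) (lambda_unif two0).
have HzX i : peval lam H ^+ i * z ^+ (h.*2 * i) = 1 by rewrite exprM -exprMn Hz expr1n.
have cycle : iter h.*2 op G = H ^+ l.*2 * G.
  apply: lam_inj; rewrite rmorphM rmorphXn /=; apply: (mulfI kap0).
  rewrite [RHS]mulrCA -(cphi_polyE charK lE h_gt0 uE) -fD E.
  by rewrite -[LHS]mul1r -(HzX l.*2) [(l.*2 * _)%N]mulnC; ring.
have itm j x := @iter_cphi_poly_mult K l h charK lE h_gt0 u t uE x j.
have P_neq0 : iter h.+2 op G != 0.
  apply/eqP => P0; have : iter h.*2 op G = 0.
    rewrite (_ : h.*2 = (h - 2) + h.+2)%N; last by lia.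
    rewrite iterD P0; elim: (h - 2)%N => //= i ->.
    by rewrite /hasse_op derivC mulr0.
  rewrite cycle => /eqP; rewrite mulf_eq0 expf_eq0 (negPf (hasse_neq0 K h)) andbF /=.
  have [s [us ss] [_ sH]] := hasse_factor.
  case: s us ss sH => [|x s] _ ss sH; first by move: ss h_gt0 => /= <-.
  by rewrite (negPf (has_mult_neq0 (itm 0 x (sH _ (mem_head _ _)) _))).
have high_mult x : root H x -> ('X - x%:P) ^+ (l + h + 4) %| iter h.+2 op G.
  move=> Hx; have [m Pm] := has_mult_exists x P_neq0.
  rewrite (has_mult_dvd _ Pm) leqNgt; apply/negP => m_lt.
  (* The step that starts from multiplicity h + (h + 1) = l. *)
  have m_ge : (l + 2 <= m)%N.
    rewrite -(has_mult_dvd _ Pm).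
    have := hasse_op_mult charK lE h_gt0 Hx (itm h.+1 x Hx (leqnn _)).
    rewrite addnS addnn -lE dvdnn -iterS => -[Q ->].
    by rewrite addn2 dvdp_mulr.
  (* A multiplicity m < l + h + 4 would meet no further multiple of l in the *)
  (* remaining h - 2 steps, and so stay below the 2l + h required at the end. *)
  have up j : (j <= h - 2)%N -> has_mult x (m + j) (iter (h.+2 + j) op G).
    elim: j => [|j IH] jh; first by rewrite !addn0.
    have := hasse_op_mult charK lE h_gt0 Hx (IH (ltnW jh)).
    rewrite ifF; first by rewrite !addnS -iterS.
    apply/negP => /dvdnP[k kl]; have : (l < k * l < 2 * l)%N by lia.
    by rewrite ltn_mul2r -{1}[l]mul1n ltn_mul2r; lia.
  have := up _ (leqnn _); rewrite (_ : h.+2 + (h - 2) = h.*2)%N; last by lia.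
  rewrite cycle => m1.
  have Hm : has_mult x 1 H.
    have [_ _ [T HT Tx]] := hasse_root_simple charK lE h_gt0 Hx.
    by exists T; rewrite // expr1.
  have := has_mult_unique m1 (has_multM (has_multX l.*2 Hm) (itm 0 x Hx _)); lia.
have [rs [us rs_size] [HE rsH]] := hasse_factor.
have sub1X : ('X - 1%:P) ^+ (4 * u) = (1 - 'X) ^+ (4 * u) :> {poly K}.
  rewrite polyC1 -opprB exprNn [(-1) ^+ _]exprM (_ : (-1) ^+ 4 = 1) ?expr1n ?mul1r //.
  by ring.
pose M := (l + h + 4)%N.
have PE : 'X^u * (1 - 'X) ^+ (4 * u) * H ^+ M %| iter h.+2 op G.
  have := @prod_XsubC_exp_dvd K ((0, u) :: (1, (4 * u)%N) :: [seq (x, M) | x <- rs])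
    (iter h.+2 op G).
  rewrite !big_cons big_map /= polyC0 subr0 sub1X prodrXl -HE mulrA; apply.
    rewrite /= -map_comp map_id us andbT inE eq_sym oner_eq0 /=; apply/andP; split.
      by apply/negP => /rsH /(hasse_root_simple charK lE h_gt0)[]; rewrite eqxx.
    by apply/negP => /rsH /(hasse_root_simple charK lE h_gt0)[_]; rewrite eqxx.
  have inv A m : A ^+ m %| G -> A %| 'X * (1 - 'X) * H ^+ 2 ->
      A ^+ m %| iter h.+2 op G.
    by move=> AG AT; elim: h.+2 => //= i IH; apply: hasse_op_dvd.
  move=> v; rewrite !inE => /or3P[/eqP->|/eqP->|/mapP[x xr ->]] /=.
  - rewrite polyC0 subr0; apply: inv; rewrite ?dvdp_mulr //.
  - rewrite sub1X; apply: inv; first by rewrite dvdp_mulr // dvdp_mull.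
    by rewrite dvdp_mulr // dvdp_mull.
  exact: high_mult (rsH x xr).
have /dvdpP[R RE] := PE; exists R.
  have [->|R0] := eqVneq R 0; first by rewrite size_poly0.
  have sM1 (P Q : {poly K}) : P != 0 -> Q != 0 -> size (P * Q) = (size P + size Q).-1.
    exact: size_mul.
  have s1X : size (1 - 'X : {poly K}) = 2 by rewrite -size_polyN opprB size_XsubC.
  have sE (P : {poly K}) i k : size P = k.+1 -> size (P ^+ i) = (k * i).+1.
    by move=> sP; rewrite -[LHS]prednK ?size_poly_gt0 ?expf_neq0 -?size_poly_gt0 ?sP // size_exp sP.
  have s1X0 : (1 - 'X : {poly K}) != 0 by rewrite -size_poly_gt0 s1X.
  have H0 : H != 0 by apply: hasse_neq0.
  have := size_iter_hasse_op charK lE h_gt0 G h.+2; rewrite RE /cphi_poly.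
  rewrite !sM1 ?mulf_neq0 ?expf_neq0 ?polyX_eq0 // (sE _ _ _ s1X).
  rewrite !(sE _ _ _ (size_hasse K h)) !size_polyXn /M lE.
  by move: (size R) => sR; nia.
have c0 : fpsC (16%:R ^+ u) != 0 :> fps K.
  by apply: contraNneq const_neq0 => /fpsP/(_ 0) /=; rewrite mulr1n => ->.
apply: (mulfI c0); rewrite E RE.
have -> : M = (h + (l + 4))%N by rewrite /M; lia.
have zE : z ^+ (l.*2 * h.+2) = z ^+ (h.*2 * (l + 4)) * z ^+ 4.
  by rewrite -exprD; congr (_ ^+ _); rewrite lE; lia.
have -> : R * ('X^u * (1 - 'X) ^+ (4 * u) * H ^+ (h + (l + 4))) =
    R * (H ^+ (l + 4) * G) by rewrite /cphi_poly exprD; ring.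
rewrite [RHS](_ : _ = fpsC (16%:R ^+ u) * (q ^+ u * C) * (z ^+ 4 * peval lam R));
  last by ring.
rewrite (cphi_polyE charK lE h_gt0 uE) 2!rmorphM rmorphXn /= zE.
by rewrite -[z ^+ 4 in RHS]mul1r -(HzX (l + 4)%N); ring.
Qed.

End LargePrimes.

(** * The first coefficients *)

Section FirstCoefficients.
Local Open Scope nat_scope.

(** The recursion of [rows_rec], in a form that computes. *)
Fixpoint row_count fuel r m : nat :=
  if fuel isn't k.+1 then 0 else
  if r isn't _.+1 then m == 0 else
  sumn [seq if (j <= r) && (r - j <= m) then row_count k (r - j) (m - (r - j)) else 0
       | j <- [:: 0; 1; 1; 2]].

Lemma size_rows_count fuel r m :
  r + m < fuel -> size (rows r m) = row_count fuel r m.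
Proof.
elim: fuel r m => // k IH [|r] m rm; first by rewrite size_rows0.
rewrite rows_rec /=; congr (_ + (_ + (_ + (_ + _)))) => //;
  by case: ifP => // c; apply: IH; lia.
Qed.

Lemma cphi2_nat_count n : cphi2_nat n =
  sumn [seq sumn [seq row_count n.+1 r m * row_count n.+1 r (n - r - m)
                 | m <- iota 0 (n - r).+1] | r <- iota 0 n.+1].
Proof.
rewrite cphi2_nat_rows sumnE big_map -[X in iota _ X]subn0 -/(index_iota 0 n.+1).
rewrite big_mkord; apply: eq_bigr => r _; rewrite sumnE big_map.
rewrite -[X in iota _ X]subn0 -/(index_iota 0 (n - r).+1) big_mkord.
have rn := ltn_ord r; apply: eq_bigr => m _; have mn := ltn_ord m.
by rewrite !(@size_rows_count n.+1) //; lia.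
Qed.

Lemma cphi2_nat_lt6 : map cphi2_nat (iota 0 6) = [:: 1; 4; 9; 20; 42; 80].
Proof. by rewrite /= !cphi2_nat_count. Qed.

End FirstCoefficients.

(** ** Two linear relations between five signs *)

(** The relations of [weight4_relations] between numbers of the form e_m (12m-1)^2 c_m,
    where c_0, ..., c_4 = 1, 4, 9, 20, 42 are the values of c phi_2. *)
Definition sign_coef (R : comNzRingType) a c x : R := a%:R * (c%:R * x%:R ^+ 2).

Definition sign_relation3 (R : comNzRingType) (e0 e1 e2 e3 : R) : R :=
  sign_coef R 1 20 35 * e3 - sign_coef R 4 9 23 * e2
  - sign_coef R 21 4 11 * e1 + sign_coef R 100 1 1 * e0.

Definition sign_relation4 (R : comNzRingType) (e0 e1 e2 e3 e4 : R) : R :=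
  sign_coef R 1 42 47 * e4 - sign_coef R 20 20 35 * e3
  + sign_coef R 63 9 23 * e2 + sign_coef R 356 4 11 * e1 - sign_coef R 1873 1 1 * e0.

Lemma sign_relations_gcd (b0 b1 b2 b3 b4 : bool) :
  BinInt.Z.modulo (30%:R ^+ 6 : BinNums.Z) (BinInt.Z.gcd
    (sign_relation3 ((-1) ^+ b0) ((-1) ^+ b1) ((-1) ^+ b2) ((-1) ^+ b3) : BinNums.Z)
    (sign_relation4 ((-1) ^+ b0) ((-1) ^+ b1) ((-1) ^+ b2) ((-1) ^+ b3)
       ((-1) ^+ b4) : BinNums.Z)) = BinNums.Z0.
Proof. by move: b0 b1 b2 b3 b4; do 5![case]; vm_compute. Qed.

Section SignMorphism.
Variables (R S : comNzRingType) (f : {rmorphism R -> S}).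

Lemma rmorph_sign_coef a c x : f (sign_coef R a c x) = sign_coef S a c x.
Proof. by rewrite /sign_coef 2!rmorphM rmorphXn !rmorph_nat. Qed.

Lemma rmorph_sign_relation3 e0 e1 e2 e3 :
  f (sign_relation3 e0 e1 e2 e3) = sign_relation3 (f e0) (f e1) (f e2) (f e3).
Proof.
have lin c3 c2 c1 c0 : f (c3 * e3 - c2 * e2 - c1 * e1 + c0 * e0) =
    f c3 * f e3 - f c2 * f e2 - f c1 * f e1 + f c0 * f e0.
  by rewrite rmorphD !rmorphB !rmorphM.
by rewrite lin !rmorph_sign_coef.
Qed.

Lemma rmorph_sign_relation4 e0 e1 e2 e3 e4 :
  f (sign_relation4 e0 e1 e2 e3 e4) =
  sign_relation4 (f e0) (f e1) (f e2) (f e3) (f e4).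
Proof.
have lin c4 c3 c2 c1 c0 :
    f (c4 * e4 - c3 * e3 + c2 * e2 + c1 * e1 - c0 * e0) =
    f c4 * f e4 - f c3 * f e3 + f c2 * f e2 + f c1 * f e1 - f c0 * f e0.
  by rewrite !rmorphD !rmorphN !rmorphM.
by rewrite lin !rmorph_sign_coef.
Qed.

End SignMorphism.

Section Signs.
Variable K : fieldType.

Lemma sign_relations_contra (b0 b1 b2 b3 b4 : bool) : 30%:R != 0 :> K ->
  sign_relation3 ((-1) ^+ b0) ((-1) ^+ b1) ((-1) ^+ b2) ((-1) ^+ b3) = 0 :> K ->
  sign_relation4 ((-1) ^+ b0) ((-1) ^+ b1) ((-1) ^+ b2) ((-1) ^+ b3) ((-1) ^+ b4) = 0 :> K ->
  False.
Proof.
pose ZK : {rmorphism BinNums.Z -> K} := (intmul 1 : int -> K) \o int_of_Z.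
move=> n30; rewrite -!(rmorph_sign ZK) -rmorph_sign_relation3 -rmorph_sign_relation4.
have := sign_relations_gcd b0 b1 b2 b3 b4.
move: (sign_relation3 _ _ _ _) (sign_relation4 _ _ _ _ _) => m n gcdE m0 n0.
have [u [v gE]] := BinInt.Z.gcd_bezout m n _ erefl.
have [w wE] : exists w, (30%:R ^+ 6 : BinNums.Z) = (u * m + v * n) * w.
  exists (BinInt.Z.div (30%:R ^+ 6) (BinInt.Z.gcd m n)).
  rewrite [LHS](Zdiv.Z_div_mod_eq_full _ (BinInt.Z.gcd m n)) gcdE [u * m + _]gE.
  by rewrite BinInt.Z.add_0_r.
have g0 : ZK (u * m + v * n) = 0 by rewrite rmorphD !rmorphM m0 n0 !mulr0 addr0.
have /eqP : ZK (30%:R ^+ 6) = 0 by rewrite wE rmorphM g0 mul0r.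
by rewrite rmorphXn rmorph_nat expf_eq0 (negPf n30).
Qed.

End Signs.

(** ** The coefficients of q^m for m < 5 *)

Section Relations.
Variable K : fieldType.
Local Notation z := (zser K).
Local Notation b := (bser K).
Local Notation C := (cphi_series K).

Definition fps_lt5 (f : fps K) (s : seq K) := forall n, (n < 5)%N -> f n = s`_n.

Lemma fps_lt5M f g s t : fps_lt5 f s -> fps_lt5 g t ->
  fps_lt5 (f * g) [:: s`_0 * t`_0; s`_0 * t`_1 + s`_1 * t`_0;
    s`_0 * t`_2 + s`_1 * t`_1 + s`_2 * t`_0;
    s`_0 * t`_3 + s`_1 * t`_2 + s`_2 * t`_1 + s`_3 * t`_0;
    s`_0 * t`_4 + s`_1 * t`_3 + s`_2 * t`_2 + s`_3 * t`_1 + s`_4 * t`_0].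
Proof.
move=> fs gt n n5; case: n n5 => [|[|[|[|[|n]]]]] n5 //;
  by rewrite fpsME !big_ord_recl big_ord0 /= addr0 ?addrA !fs // !gt.
Qed.

Lemma cphi_series_lt5 : fps_lt5 C [:: 1; 4%:R; 9%:R; 20%:R; 42%:R].
Proof.
have [c0 c1 c2 c3 c4 _] := cphi2_nat_lt6; move=> n n5.
by case: n n5 => [|[|[|[|[|]]]]] //= _; rewrite ?c0 ?c1 ?c2 ?c3 ?c4.
Qed.

Lemma zser_sqr_lt5 : fps_lt5 (z ^+ 2) [:: 1; 8%:R; 24%:R; 32%:R; 24%:R].
Proof.
have z5 : fps_lt5 z [:: 1; 4%:R; 4%:R; 0; 4%:R].
  rewrite zser.unlock expr2 => n n5; rewrite (fps_lt5M (@phi_coef K) (@phi_coef K)) //.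
  by case: n n5 => [|[|[|[|[|]]]]] //= _; ring.
rewrite expr2 => n n5; rewrite (fps_lt5M z5 z5) //.
by case: n n5 => [|[|[|[|[|]]]]] //= _; ring.
Qed.

Lemma bser_sqr_lt5 : fps_lt5 (b ^+ 2) [:: 1; - 8%:R; 24%:R; - 32%:R; 24%:R].
Proof.
have b5 : fps_lt5 b [:: 1; - 4%:R; 4%:R; 0; 4%:R].
  rewrite bser.unlock expr2 => n n5; rewrite (fps_lt5M (@psi_coef K) (@psi_coef K)) //.
  by case: n n5 => [|[|[|[|[|]]]]] //= _; ring.
rewrite expr2 => n n5; rewrite (fps_lt5M b5 b5) //.
by case: n n5 => [|[|[|[|[|]]]]] //= _; ring.
Qed.

(** The three-dimensional space spanned by C z^4, C z^2 b^2 and C b^4 satisfies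
    these two relations between the coefficients of 1, q, ..., q^4. *)
Lemma weight4_relations (r0 r1 r2 : K)
    (F := C * (fpsC r0 * (z ^+ 2 * z ^+ 2) + fpsC r1 * (z ^+ 2 * b ^+ 2)
               + fpsC r2 * (b ^+ 2 * b ^+ 2))) :
  F 3 - 4%:R * F 2 - 21%:R * F 1 + 100%:R * F 0 = 0 /\
  F 4 - 20%:R * F 3 + 63%:R * F 2 + 356%:R * F 1 - 1873%:R * F 0 = 0.
Proof.
have Q5 : fps_lt5 (fpsC r0 * (z ^+ 2 * z ^+ 2) + fpsC r1 * (z ^+ 2 * b ^+ 2)
               + fpsC r2 * (b ^+ 2 * b ^+ 2))
    [:: r0 + r1 + r2; 16%:R * r0 - 16%:R * r2; 112%:R * r0 - 16%:R * r1 + 112%:R * r2;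
        448%:R * r0 - 448%:R * r2; 1136%:R * r0 + 112%:R * r1 + 1136%:R * r2].
  move=> n n5; rewrite !fpsDE !fpsCME.
  rewrite (fps_lt5M zser_sqr_lt5 zser_sqr_lt5) // (fps_lt5M zser_sqr_lt5 bser_sqr_lt5) //.
  rewrite (fps_lt5M bser_sqr_lt5 bser_sqr_lt5) //.
  by case: n n5 => [|[|[|[|[|]]]]] //= _; ring.
rewrite /F !(fps_lt5M cphi_series_lt5 Q5) //=.
by split; ring.
Qed.

End Relations.

(** * Congruences modulo 2 and 5 *)

(** In characteristic 2 the theta series is 1, hence C is a square. *)
Lemma cphi2_odd_char2 (K : fieldType) n : 2%N \in [pchar K] -> odd n ->
  (cphi2_nat n)%:R = 0 :> K.
Proof.
move=> char2 on; rewrite -[LHS]/(cphi_series K n) cphi_series_theta.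
have theta1 : theta (1 : K) = 1.
  rewrite theta.unlock; apply/fpsP => m; rewrite fsumE big_ord_recl big1 ?addr0.
    by rewrite /theta_term mul1r expr0.
  move=> i _; rewrite (_ : theta_term _ _ = 0) //.
  by rewrite /theta_term /= (fps_char char2) mul0r.
have := eulerD_expl char2 (partition_series K) => /fpsP/(_ n).
rewrite theta1 mulr1 /= => /eqP; rewrite mulf_eq0 (natr_eq0_char char2) dvdn2 on /=.
by move/eqP.
Qed.

(** For l = 5 the series q^2 C is, up to factors killed by D, the derivative of a
    polynomial in lambda. *)
Lemma cphi2_mod5_char5 (K : fieldType) n : 5%N \in [pchar K] -> n = 3 %[mod 5] ->
  (cphi2_nat n)%:R = 0 :> K.
Proof.
move=> char5 n3; pose h := 2%N; have lE : 5%N = h.*2.+1 by [].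
have two0 : 2%:R != 0 :> K by apply: (natr_lt_neq0 char5).
have h0 : (0 < h)%N by [].
have uE : ((12 * 2).+1 = 5 * 5)%N by [].
have fE := cphi_polyE char5 lE h0 uE; set f := qvar K ^+ 2 * cphi_series K in fE.
have Hz := hasse_lambda char5 lE h0.
pose lam := lambda K; pose z := zser K; pose kap := cphi_const K 5 h 5.
(* The choice of P is explained by q^2 C = kap lambda^2 (1 - lambda)^8 H(lambda)^2, *)
(* up to a constant, and D lambda = lambda (1 - lambda) z^2. *)
pose P : {poly K} := 6%:R *: 'X^2 - 8%:R *: 'X^3 + 3%:R *: 'X^4.
have P' : P^`() = 12%:R * ('X * (1 - 'X) ^+ 2).
  rewrite /P derivD derivB !derivZ !derivXn /= -!mul_polyC !polyC_natr; ring.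
pose g := (1 - lam) ^+ 5 * kap * peval lam P.
have Dg : fpsC (12%:R * 16%:R ^+ 2) * f * z ^+ 10 = eulerD g.
  have D5 : eulerD ((1 - lam) ^+ 5 * kap) = 0.
    by rewrite eulerDM (eulerD_expl char5) (eulerD_cphi_const h char5) mul0r mulr0 addr0.
  rewrite /g eulerDM D5 mul0r add0r eulerD_peval (eulerD_lambda two0) P'.
  have -> : peval lam (12%:R * ('X * (1 - 'X) ^+ 2)) = 12%:R * (lam * (1 - lam) ^+ 2).
    by rewrite 2!rmorphM rmorph_nat rmorphXn rmorphB rmorph1 /= pevalX.
  have -> : fpsC (12%:R * 16%:R ^+ 2) * f = 12%:R * (fpsC (16%:R ^+ 2) * f).
    by rewrite rmorphM rmorph_nat mulrA.
  have -> : fpsC (16%:R ^+ 2) * f =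
      kap * (lam ^+ 2 * (1 - lam) ^+ 8 * peval lam (hasse K h) ^+ 2).
    rewrite fE; congr (_ * _); rewrite /cphi_poly 2!rmorphM !rmorphXn rmorphB rmorph1 /=.
    by rewrite pevalX.
  move: Hz; rewrite -/lam -/z (_ : h.*2 = 4) //; move: (peval lam (hasse K h)) => H1 Hz1.
  transitivity (12%:R * kap * lam ^+ 2 * (1 - lam) ^+ 8 * z ^+ 2 * (H1 * z ^+ 4) ^+ 2).
    by ring.
  by rewrite Hz1; ring.
have zu : z \is a GRing.unit by apply: zser_unit.
have fD : fpsC (12%:R * 16%:R ^+ 2) * f = eulerD (g * (z ^- 2) ^+ 5).
  rewrite eulerDM (eulerD_expl char5) mulr0 addr0 -Dg -mulrA -exprVn -exprM -exprMn.
  by rewrite divrr // expr1n mulr1.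
have c0 : 12%:R * 16%:R ^+ 2 != 0 :> K by rewrite -natrX -natrM (natr_eq0_char char5).
apply: (mulfI c0); rewrite mulr0 -[(cphi2_nat n)%:R]/(cphi_series K n).
have fn : f n.+2 = cphi_series K n by rewrite /f qvarXME /= subn2.
have n5 : n.+2%:R = 0 :> K.
  by apply/eqP; rewrite (natr_eq0_char char5) /dvdn -addn2 -modnDml n3.
by have /fpsP/(_ n.+2) := fD; rewrite fpsCME fn => ->; rewrite /= n5 mul0r.
Qed.

(** * No congruence modulo a prime greater than 5 *)

Section NoCongruence.
Variables (K : closedFieldType) (l h u t : nat).
Hypothesis charK : l \in [pchar K].
Hypothesis lE : l = h.*2.+1.
Hypothesis h_ge3 : (2 < h)%N.
Hypothesis uE : (12 * u).+1 = (l * t)%N.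
Local Notation z := (zser K).
Local Notation b := (bser K).
Local Notation lam := (lambda K).
Local Notation C := (cphi_series K).
Local Notation q := (qvar K).

(** A form of degree 2 in z^2 and b^2, as lambda z^2 = z^2 - b^2. *)
Lemma peval_lambda_size3 (R : {poly K}) : (size R <= 3)%N ->
  z ^+ 4 * peval lam R =
  fpsC (R`_0 + R`_1 + R`_2) * (z ^+ 2 * z ^+ 2)
  + fpsC (- (R`_1 + R`_2 *+ 2)) * (z ^+ 2 * b ^+ 2) + fpsC R`_2 * (b ^+ 2 * b ^+ 2).
Proof.
have two0 : 2%:R != 0 :> K by apply: (natr_lt_neq0 charK); lia.
move=> sR; rewrite -(one_sub_lambda K).
have -> : R = (R`_0)%:P + R`_1 *: 'X + R`_2 *: 'X^2.
  apply/polyP => i; rewrite !coefD !coefZ coefC coefX coefXn.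
  case: i => [|[|[|i]]] /=; rewrite ?mulr0 ?mulr1 ?addr0 ?add0r //.
  by rewrite nth_default // (leq_trans sR).
rewrite rmorphD rmorphD -!mul_polyC 2!rmorphM rmorphXn /= pevalX !pevalC.
rewrite !coefD !coefCM !coefC !coefX !coefXn /= !(mulr0, mulr1, addr0, add0r).
rewrite !rmorphD rmorphN rmorphD rmorphMn /=.
by ring.
Qed.

Lemma half_power_sign n : exists e : bool,
  n%:R ^+ h.+2 = (-1) ^+ e * n%:R ^+ 2 :> K.
Proof.
have [n0|n0] := eqVneq (n%:R : K) 0; first by exists false; rewrite n0 !expr0n mulr0.
have : (n%:R ^+ h) ^+ 2 == 1 :> K by rewrite -exprM muln2 (fermat charK lE).
rewrite sqrf_eq1 -[h.+2]addn2 exprD => /orP[]/eqP ->; first by exists false; rewrite expr0.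
by exists true; rewrite expr1.
Qed.

(** Comparing coefficients in [congruence_zero] gives (12m-1)^(h+2) c_m up to a constant,
    where (12m-1)^h is 1, -1 or 0, as the coefficients of a series to which
    [weight4_relations] applies. *)
Lemma no_congruence_zero : (forall n, (l %| n)%N -> (q ^+ u * C) n = 0) -> False.
Proof.
move=> /(congruence_zero charK lE h_ge3 uE)[R sR DR].
set F := C * (z ^+ 4 * peval lam R).
have FE m : (u + m)%:R ^+ h.+2 * C m = F m.
  have -> : F m = (q ^+ u * F) (u + m)%N by rewrite qvarXME leq_addr addKn.
  have -> : q ^+ u * F = iter h.+2 (@eulerD K) (q ^+ u * C) by rewrite DR /F; ring.
  by rewrite iter_eulerDE qvarXME leq_addr addKn.
have [e eE] := boolp.choice (fun m => half_power_sign (12 * (u + m))).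
(* The left-hand side exceeds the other by 12u + 1, a multiple of l. *)
have uN m : (12 * (u + m))%:R = (12 * m)%:R - 1 :> K.
  apply/eqP; rewrite mulnDr natrD -subr_eq0 [X in X == _](_ : _ = (12 * u).+1%:R); last first.
    by rewrite -[RHS]natr1; ring.
  by rewrite uE (natr_eq0_char charK) dvdn_mulr.
pose k : K := 12%:R ^+ h.+2.
have T m : k * F m = (-1) ^+ e m * ((12 * m)%:R - 1) ^+ 2 * C m.
  by rewrite -FE /k mulrA -exprMn -natrM eE uN.
have [c0 c1 c2 c3 c4] : [/\ C 0 = 1, C 1 = 4%:R, C 2 = 9%:R, C 3 = 20%:R & C 4 = 42%:R].
  by split; rewrite cphi_series_lt5.
have n30 : 30%:R != 0 :> K.
  have l_prime := pcharf_prime charK.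
  rewrite (natr_eq0_char charK) (Euclid_dvdM 6 5) // (Euclid_dvdM 3 2) //.
  by rewrite !gtnNdvd //; lia.
have [rel3 rel4] := weight4_relations (R`_0 + R`_1 + R`_2) (- (R`_1 + R`_2 *+ 2)) R`_2.
rewrite -peval_lambda_size3 // -/F in rel3 rel4.
apply: (sign_relations_contra (b0 := e 0) (b1 := e 1) (b2 := e 2) (b3 := e 3) (b4 := e 4) n30).
  transitivity (k * F 3 - 4%:R * (k * F 2) - 21%:R * (k * F 1) + 100%:R * (k * F 0)).
    by rewrite !T c0 c1 c2 c3 /sign_relation3 /sign_coef; ring.
  by rewrite -[RHS](mulr0 k) -rel3; ring.
transitivity (k * F 4 - 20%:R * (k * F 3) + 63%:R * (k * F 2) + 356%:R * (k * F 1)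
  - 1873%:R * (k * F 0)).
  by rewrite !T c0 c1 c2 c3 c4 /sign_relation4 /sign_coef; ring.
by rewrite -[RHS](mulr0 k) -rel4; ring.
Qed.

End NoCongruence.

Lemma no_congruence (K : closedFieldType) l a : l \in [pchar K] -> (5 < l)%N ->
  (forall n, n = a %[mod l] -> (cphi2_nat n)%:R = 0 :> K) -> False.
Proof.
move=> charK l5 ca; have l_prime := pcharf_prime charK.
have lodd : odd l.
  by case: (even_prime l_prime) => // l2; rewrite l2 in l5.
pose h := l./2; have lE : l = h.*2.+1 by rewrite -[LHS]odd_double_half lodd.
have h3 : (2 < h)%N by lia.
have co : coprime l 12.
  rewrite prime_coprime // (Euclid_dvdM 3 4) // (Euclid_dvdM 2 2) //.
  by rewrite !gtnNdvd //; lia.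
have l0 : (0 < l)%N by lia.
case: (egcdnP 12 l0) => t u; rewrite (eqP co) addn1 ![(_ * l)%N]mulnC [(u * _)%N]mulnC.
move=> uE _; have {}uE := esym uE.
have qC n : n = a + u %[mod l] -> (qvar K ^+ u * cphi_series K) n = 0.
  move=> nE; rewrite qvarXME; case: leqP => // un; apply: ca.
  by apply/eqP; rewrite -(eqn_modDr u) subnK // nE.
have [lr|lr] := boolP (l %| a + u)%N; last exact: (no_congruence_nonzero charK lE h3 uE lr qC).
apply: (no_congruence_zero charK lE h3 uE) => n ln; apply: qC.
by rewrite (eqP lr) (eqP ln).
Qed.

(** * The congruences of c phi_2 *)

Local Close Scope ring_scope.

(** Negative arguments contribute nothing, since c phi_2 vanishes there. *)
Lemma cphi2_residue_class l r (a : int) : 0 < l -> (a = r%:Z %[mod l])%Z ->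
  (forall n : int, cphi2 (l%:Z * n + a)%R = 0 %[mod l]) <->
  (forall m : nat, m = r %[mod l] -> l %| cphi2_nat m).
Proof.
move=> l0 ar; split=> [H m mr|H n].
  have /dvdzP[n nE] : (l %| (m%:Z - a)%R)%Z.
    by rewrite -eqz_mod_dvd ar !modz_nat mr.
  have := H n; rewrite (_ : (l%:Z * n + a)%R = m) => [|]; first by rewrite mod0n => /eqP.
  by rewrite mulrC -nE subrK.
case E : (l%:Z * n + a)%R => [m|m]; rewrite mod0n //=; apply/eqP/H.
have : (m%:Z = r %[mod l])%Z by rewrite -E mulrC modzMDl.
by rewrite !modz_nat => -[].
Qed.

Lemma no_congruence_prime l r : prime l -> 5 < l ->
  ~ (forall m : nat, m = r %[mod l] -> l %| cphi2_nat m).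
Proof.
move=> l_prime l5 H; have [K [f _]] := countable_algebraic_closure 'F_l.
have charK : l \in [pchar K]%R by rewrite (fmorph_pchar f) pchar_Fp.
apply: (@no_congruence K l r charK l5) => m mr; apply/eqP.
by rewrite (natr_eq0_char charK) H.
Qed.

Theorem theorem1p1 (l : nat) (l_prime : prime l) (a : int) :
  (forall n : int, cphi2 (l%:Z * n + a)%R = 0 %[mod l]) <->
  (l = 2 /\ (a = 1 %[mod 2])%Z) \/ (l = 5 /\ (a = 3 %[mod 5])%Z).
Proof.
have l0 := prime_gt0 l_prime.
have [r rl ar] : exists2 r, r < l & (a = r%:Z %[mod l])%Z.
  have lz : (0 < l%:Z)%R by [].
  have := ltz_pmod a lz; have := modz_ge0 a (lt0r_neq0 lz).
  case E : (a %% l)%Z => [r|//] _ rl.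
  by exists r; rewrite // -E modz_mod.
have [c0 c1 c2 c3 c4 c5] := cphi2_nat_lt6.
rewrite (cphi2_residue_class l0 ar); split=> [H|[[lE a1]|[lE a3]]].
- have [l5|l_le] := ltnP 5 l; first by case: (no_congruence_prime l_prime l5 H).
  have l23 : [\/ l = 2, l = 3 | l = 5].
    by case: l l_prime l_le {H ar l0 rl} => [|[|[|[|[|[|]]]]]] //; by constructor.
  case: l23 => lE; subst l.
  + left; split=> //.
    by case: r rl ar H => [|[|]] // _ _ /(_ 0 erefl); rewrite c0.
  + by case: r rl {ar} H => [|[|[|]]] // _;
      [move/(_ 0 erefl) | move/(_ 1 erefl) | move/(_ 5 erefl)]; rewrite ?c0 ?c1 ?c5.
  right; split=> //; case: r rl ar H => [|[|[|[|[|]]]]] // _ _.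
  + by move/(_ 0 erefl); rewrite c0.
  + by move/(_ 1 erefl); rewrite c1.
  + by move/(_ 2 erefl); rewrite c2.
  by move/(_ 4 erefl); rewrite c4.
- subst l => m mr; have char2 := @pchar_Fp 2 isT.
  rewrite -(natr_eq0_char char2) cphi2_odd_char2 //.
  have /eqP := mr; rewrite !modn2; move: ar; rewrite a1 !modz_nat !modn2 => -[<-] /eqP.
  by case: odd.
subst l => m mr; have char5 := @pchar_Fp 5 isT.
rewrite -(natr_eq0_char char5) cphi2_mod5_char5 // mr.
by move: ar; rewrite a3 !modz_nat => -[].
Qed.
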